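(* Let $\mathbb{K}$ be a field of characteristic zero and let $n=3$. For an integer $m\geq 1$, the statement ''every $m$-triangular automorphism in $\mathrm{GA}_3(\mathbb{K})$ is either affine or co-tame'' is true if and only if $m\leq 3$.
   Context: $\mathrm{GA}_n(\mathbb{K})$ is the group of polynomial automorphisms of $\mathbb{A}^n_{\mathbb{K}}$. An element $\phi$ is written $\phi=(H_1,\ldots,H_n)$ with $H_i=(x_i)\phi\in\mathbb{K}[x_1,\ldots,x_n]$; for a polynomial $P$ one writes $(P)\phi=P(H_1,\ldots,H_n)$, and composition satisfies $(P)(\phi\psi)=((P)\phi)\psi$. $\mathrm{Aff}_n(\mathbb{K})$ is the affine subgroup (automorphisms all of whose components have degree one). $\mathrm{BA}_n(\mathbb{K})$ is the subgroup of triangular automorphisms $(u_1x_1+P_1,u_2x_2+P_2(x_1),\ldots,u_nx_n+P_n(x_1,\ldots,x_{n-1}))$ with $u_i\in\mathbb{K}^*$ and $P_i\in\mathbb{K}[x_1,\ldots,x_{i-1}]$. $\mathrm{TA}_n(\mathbb{K})=\langle \mathrm{Aff}_n(\mathbb{K}),\mathrm{BA}_n(\mathbb{K})\rangle$ is the tame subgroup. An automorphism $\phi\in\mathrm{GA}_n(\mathbb{K})$ is co-tame if $\mathrm{TA}_n(\mathbb{K})\subset\langle \phi,\mathrm{Aff}_n(\mathbb{K})\rangle$. An automorphism is $m$-triangular if it can be written as $\alpha_0\tau_1\alpha_1\cdots\tau_m\alpha_m$ with each $\tau_i\in\mathrm{BA}_n(\mathbb{K})$ and each $\alpha_i\in\mathrm{Aff}_n(\mathbb{K})$.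 *)

(* Defs.v *)
From HB Require Import structures.
From mathcomp Require Import all_boot all_algebra.
From mathcomp.multinomials Require Export mpoly.

Set Implicit Arguments.
Unset Strict Implicit.
Unset Printing Implicit Defensive.

Import GRing.Theory.
Local Open Scope group_scope.

(* [p \mPo H] is p(H_1, ..., H_n), written (p)H below. Substitution acts on the
   right: (p)(pcomp H G) = ((p)H)G, see [comp_pcomp]. *)
Definition pcomp (n : nat) (K : fieldType) (H G : n.-tuple {mpoly K[n]}) :
  n.-tuple {mpoly K[n]} := [tuple tnth H i \mPo G | i < n].

Definition pid (n : nat) (K : fieldType) : n.-tuple {mpoly K[n]} :=
  [tuple 'X_i | i < n].

Lemma comp_pcomp (n : nat) (K : fieldType) (p : {mpoly K[n]})
    (H G : n.-tuple {mpoly K[n]}) : (p \mPo H) \mPo G = p \mPo pcomp H G.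
Proof.
rewrite (comp_mpolyEX p H) (comp_mpolyEX p (pcomp H G)) raddf_sum /=.
apply: eq_bigr => mu _; rewrite comp_mpolyZ; congr (_ *: _)%R.
rewrite !comp_mpolyX rmorph_prod /=.
by apply: eq_bigr => i _; rewrite rmorphXn /= tnth_mktuple.
Qed.

Lemma pcompA (n : nat) (K : fieldType) : associative (@pcomp n K).
Proof.
move=> H G F; apply: eq_from_tnth => i.
by rewrite !tnth_mktuple comp_pcomp.
Qed.

Lemma pcomp1g (n : nat) (K : fieldType) : left_id (pid n K) (@pcomp n K).
Proof.
move=> H; apply: eq_from_tnth => i.
by rewrite !tnth_mktuple comp_mpolyXU -tnth_nth.
Qed.

Lemma pcompg1 (n : nat) (K : fieldType) : right_id (pid n K) (@pcomp n K).
Proof.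
by move=> H; apply: eq_from_tnth => i; rewrite tnth_mktuple comp_mpoly_id.
Qed.

(* Polynomial automorphisms of affine n-space, stored together with their
   inverse; the inverse is redundant, see [GA_inj] and [GA_ex]. *)
Record GA (n : nat) (K : fieldType) := MkGA {
  GA_pair : n.-tuple {mpoly K[n]} * n.-tuple {mpoly K[n]};
  GA_pairP : (pcomp GA_pair.1 GA_pair.2 == pid n K)
             && (pcomp GA_pair.2 GA_pair.1 == pid n K) }.

HB.instance Definition _ (n : nat) (K : fieldType) := [isSub for @GA_pair n K].
HB.instance Definition _ (n : nat) (K : fieldType) :=
  [Choice of GA n K by <:].

Definition GA_tuple (n : nat) (K : fieldType) (phi : GA n K) := (val phi).1.

Definition component (n : nat) (K : fieldType) (phi : GA n K) (i : 'I_n) :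
  {mpoly K[n]} := tnth (GA_tuple phi) i.

Lemma GA_inj (n : nat) (K : fieldType) : injective (@GA_tuple n K).
Proof.
move=> [[H H'] /= pH] [[G G'] /= pG]; rewrite /GA_tuple /= => eHG.
apply: val_inj => /=; subst G; congr pair.
case/andP: pH => _ /eqP H'H; case/andP: pG => /eqP HG' _.
by rewrite -[LHS]pcompg1 -HG' pcompA H'H pcomp1g.
Qed.

Lemma GA_ex (n : nat) (K : fieldType) (H H' : n.-tuple {mpoly K[n]}) :
  pcomp H H' = pid n K -> pcomp H' H = pid n K ->
  exists phi : GA n K, GA_tuple phi = H.
Proof.
move=> HH' H'H.
have pH : (pcomp (H, H').1 (H, H').2 == pid n K)
          && (pcomp (H, H').2 (H, H').1 == pid n K).
  by rewrite /= HH' H'H !eqxx.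
by exists (MkGA pH).
Qed.

Lemma GA_one_subproof (n : nat) (K : fieldType) :
  (pcomp (pid n K, pid n K).1 (pid n K, pid n K).2 == pid n K)
  && (pcomp (pid n K, pid n K).2 (pid n K, pid n K).1 == pid n K).
Proof. by rewrite /= pcomp1g eqxx. Qed.

Definition GA_one (n : nat) (K : fieldType) : GA n K :=
  MkGA (GA_one_subproof n K).

Lemma GA_inv_subproof (n : nat) (K : fieldType) (phi : GA n K)
    (q := ((val phi).2, (val phi).1)) :
  (pcomp q.1 q.2 == pid n K) && (pcomp q.2 q.1 == pid n K).
Proof. by rewrite andbC; exact: GA_pairP phi. Qed.

Definition GA_inv (n : nat) (K : fieldType) (phi : GA n K) : GA n K :=
  MkGA (GA_inv_subproof phi).

Lemma GA_mul_subproof (n : nat) (K : fieldType) (phi psi : GA n K)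
    (q := (pcomp (val phi).1 (val psi).1, pcomp (val psi).2 (val phi).2)) :
  (pcomp q.1 q.2 == pid n K) && (pcomp q.2 q.1 == pid n K).
Proof.
rewrite {}/q; case: phi psi => [[H H'] /= /andP[/eqP e1 /eqP e2]].
case=> [[G G'] /= /andP[/eqP e3 /eqP e4]].
rewrite -[pcomp (pcomp H G) _]pcompA (pcompA G) e3 pcomp1g e1.
by rewrite -[pcomp (pcomp G' H') _]pcompA (pcompA H') e2 pcomp1g e4 !eqxx.
Qed.

Definition GA_mul (n : nat) (K : fieldType) (phi psi : GA n K) : GA n K :=
  MkGA (GA_mul_subproof phi psi).

Lemma GA_mulA (n : nat) (K : fieldType) : associative (@GA_mul n K).
Proof. by move=> f g h; apply: GA_inj; exact: pcompA. Qed.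

Lemma GA_mul1g (n : nat) (K : fieldType) :
  left_id (GA_one n K) (@GA_mul n K).
Proof. by move=> f; apply: GA_inj; exact: pcomp1g. Qed.

Lemma GA_mulg1 (n : nat) (K : fieldType) :
  right_id (GA_one n K) (@GA_mul n K).
Proof. by move=> f; apply: GA_inj; exact: pcompg1. Qed.

Lemma GA_mulVg (n : nat) (K : fieldType) :
  left_inverse (GA_one n K) (@GA_inv n K) (@GA_mul n K).
Proof.
by move=> f; apply: GA_inj; case/andP: (GA_pairP f) => _ /eqP e; exact: e.
Qed.

Lemma GA_mulgV (n : nat) (K : fieldType) :
  right_inverse (GA_one n K) (@GA_inv n K) (@GA_mul n K).
Proof.
by move=> f; apply: GA_inj; case/andP: (GA_pairP f) => /eqP e _; exact: e.
Qed.

HB.instance Definition _ (n : nat) (K : fieldType) :=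
  isGroup.Build (GA n K) (@GA_mulA n K) (@GA_mul1g n K) (@GA_mulg1 n K)
    (@GA_mulVg n K) (@GA_mulgV n K).

Inductive generated (G : groupType) (X : G -> Prop) : G -> Prop :=
| gen_incl x : X x -> generated X x
| gen_one : generated X 1
| gen_mul x y : generated X x -> generated X y -> generated X (x * y)
| gen_inv x : generated X x -> generated X x^-1.

(* [msize] is the total degree plus one. *)
Definition affine (n : nat) (K : fieldType) (phi : GA n K) : Prop :=
  forall i, msize (component phi i) = 2%N.

(* Indices start at 0: P lies in K[x_0, ..., x_(k-1)]. *)
Definition in_first_vars (n : nat) (K : fieldType) (k : nat)
    (P : {mpoly K[n]}) : Prop :=
  forall mu, mu \in msupp P -> forall j : 'I_n, k <= j -> mu j = 0%N.

Definition triangular (n : nat) (K : fieldType) (phi : GA n K) : Prop :=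
  exists (u : 'I_n -> K) (P : 'I_n -> {mpoly K[n]}), forall i,
    [/\ u i != 0%R, in_first_vars i (P i)
      & component phi i = (u i *: 'X_i + P i)%R].

Definition tame (n : nat) (K : fieldType) : GA n K -> Prop :=
  generated (fun phi => affine phi \/ triangular phi).

Definition cotame (n : nat) (K : fieldType) (phi : GA n K) : Prop :=
  forall psi, tame psi -> generated (fun g => g = phi \/ affine g) psi.

(* phi = alpha_0 tau_1 alpha_1 ... tau_m alpha_m; the values of alpha and tau
   outside the stated index ranges are irrelevant. *)
Definition m_triangular (n : nat) (K : fieldType) (m : nat) (phi : GA n K) :
    Prop :=
  exists alpha tau : nat -> GA n K,
    [/\ forall i, i <= m -> affine (alpha i),
        forall i, 1 <= i <= m -> triangular (tau i)
      & phi = alpha 0 * \prod_(1 <= i < m.+1) (tau i * alpha i)].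

(* Main.v *)
Require Import Defs.
From mathcomp Require Import all_boot all_algebra.
From mathcomp Require Import perm ring zify.

(* Composition reads from the left: the i-th component of phi * psi is the i-th
   component of phi with the components of psi substituted. Let t be the
   translation x2 -> x2 + 1 and G a group of automorphisms containing Aff_3.

   m <= 3. If psi in G commutes with t up to a power of t, then psi is affine or
   G contains all tame automorphisms: conjugating x2 -> x2 + x_i by psi gives
   elementary automorphisms, and one nonaffine elementary automorphism produces,
   with affine maps and commutators, all of them. If phi in G only satisfies
   phi t phi^-1 = A with A affine, then A is unipotent without fixed points; in
   suitable coordinates the dilation L of weights (2, 4, 8) satisfies
   L A = A^2 L, so psi = phi^-1 L phi satisfies psi t = t^2 psi. If this psi is
   nonaffine we are done; if it is affine, then phi, composed with an affine map,
   commutes with L, hence is weighted homogeneous, and the previous case applies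
   to it. Finally, if phi = tau1 a1 tau2 a2 tau3, then phi t phi^-1 and t are
   conjugates, by the same element tau1 a1, of a unitriangular automorphism and
   of a translation. Hence iterated commutators of phi t phi^-1 with t become
   trivial, and the previous step, applied to the last nonaffine one of them (or
   to phi if there is none), concludes.

   m >= 4. For two elementary automorphisms sP : x2 -> x2 + x1^2 x0^3 + x1 x0 and
   sR : x2 -> x2 + x1^2 x0, and the swap s of x1 and x2, the involution
   theta = sP^-1 s sR^-1 s sR s sP is 4-triangular. A ping-pong argument on degrees
   shows that the elements of <theta, Aff_3> are affine or have large degree, so
   that x2 -> x2 + x1^2 is not among them. *)

Set Implicit Arguments.
Unset Strict Implicit.
Unset Printing Implicit Defensive.

Import GRing.Theory.
Local Open Scope ring_scope.

Local Notation i0 := (@Ordinal 3 0 isT).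
Local Notation i1 := (@Ordinal 3 1 isT).
Local Notation i2 := (@Ordinal 3 2 isT).

(** * Composition and substitution for automorphisms *)

Lemma comp_GAM (n : nat) (K : fieldType) (phi psi : GA n K) i :
  component (phi * psi)%g i = component phi i \mPo GA_tuple psi.
Proof. by rewrite /component tnth_mktuple. Qed.

Lemma comp_GA1 (n : nat) (K : fieldType) i : component (1%g : GA n K) i = 'X_i.
Proof. by rewrite /component tnth_mktuple. Qed.

Lemma pullM (n : nat) (K : fieldType) (phi psi : GA n K) p :
  p \mPo GA_tuple (phi * psi)%g = (p \mPo GA_tuple phi) \mPo GA_tuple psi.
Proof. by rewrite comp_pcomp. Qed.

Lemma pull1 (n : nat) (K : fieldType) p : p \mPo GA_tuple (1%g : GA n K) = p.
Proof. exact: comp_mpoly_id. Qed.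

Lemma pullX (n : nat) (K : fieldType) (t : n.-tuple {mpoly K[n]}) i :
  'X_i \mPo t = tnth t i.
Proof. by rewrite comp_mpolyXU -tnth_nth. Qed.

Lemma GA_ext (n : nat) (K : fieldType) (phi psi : GA n K) :
  (forall i, component phi i = component psi i) -> phi = psi.
Proof. by move=> e; apply: GA_inj; apply: eq_from_tnth. Qed.

Lemma pull_inj (n : nat) (K : fieldType) (phi : GA n K) :
  injective (comp_mpoly (GA_tuple phi)).
Proof.
move=> p q e; rewrite -[p]pull1 -[q]pull1 -(mulgV phi).
by rewrite !pullM [p \mPo _]e.
Qed.

(* The identity if H' is not the inverse of H. *)
Definition mkGA (n : nat) (K : fieldType) (H H' : n.-tuple {mpoly K[n]}) :
  GA n K := insubd (GA_one n K) (H, H').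

Lemma mkGAE (n : nat) (K : fieldType) (H H' : n.-tuple {mpoly K[n]}) :
  (forall i, tnth H i \mPo H' = 'X_i) -> (forall i, tnth H' i \mPo H = 'X_i) ->
  GA_tuple (mkGA H H') = H.
Proof.
move=> e e'; rewrite /GA_tuple /mkGA val_insubd.
have -> : Defs.pcomp H H' = pid n K.
  by apply: eq_from_tnth => i; rewrite !tnth_mktuple e.
have -> : Defs.pcomp H' H = pid n K.
  by apply: eq_from_tnth => i; rewrite !tnth_mktuple e'.
by rewrite !eqxx.
Qed.

(* Locking the explicit automorphisms keeps unification from computing
   compositions of polynomials when it compares two of them. *)
Fact GA_key (k : nat) : unit. Proof. exact: tt. Qed.

(** * Affine maps *)

Definition aff_comp (n : nat) (K : fieldType) (M : 'M[K]_n) (b : 'cV[K]_n) i :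
  {mpoly K[n]} := \sum_j M i j *: 'X_j + (b i 0)%:MP.

Definition aff (n : nat) (K : fieldType) : 'M[K]_n -> 'cV[K]_n -> GA n K :=
  locked_with (GA_key 0) (fun M b =>
    mkGA (mktuple (aff_comp M b))
         (mktuple (aff_comp (invmx M) (- invmx M *m b)))).

Lemma aff_comp_comp (n : nat) (K : fieldType) (M : 'M[K]_n) b M' b' i :
  aff_comp M b i \mPo mktuple (aff_comp M' b')
  = aff_comp (M *m M') (M *m b' + b) i.
Proof.
rewrite /aff_comp raddfD /= comp_mpolyC raddf_sum /=.
under eq_bigr => j _ do rewrite comp_mpolyZ pullX tnth_mktuple scalerDr scaler_sumr.
rewrite big_split /= exchange_big /= !mxE mpolyCD addrA; congr (_ + _ + _).
  apply: eq_bigr => j _; rewrite mxE scaler_suml.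
  by apply: eq_bigr => k _; rewrite scalerA.
rewrite raddf_sum /=; apply: eq_bigr => j _.
by rewrite -mul_mpolyC -mpolyCM.
Qed.

Lemma aff_comp1 (n : nat) (K : fieldType) i :
  aff_comp 1%:M (0 : 'cV[K]_n) i = 'X_i.
Proof.
rewrite /aff_comp mxE mpolyC0 addr0 (bigD1 i) //= mxE eqxx scale1r.
by rewrite big1 ?addr0 // => j ji; rewrite mxE eq_sym (negPf ji) scale0r.
Qed.

Lemma affE (n : nat) (K : fieldType) (M : 'M[K]_n) b : M \in unitmx ->
  GA_tuple (aff M b) = mktuple (aff_comp M b).
Proof.
move=> uM; rewrite /aff unlock; apply: mkGAE => i; rewrite tnth_mktuple aff_comp_comp.
  by rewrite mulmxV // mulNmx mulmxN mulmxA mulmxV // mul1mx addNr aff_comp1.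
by rewrite mulVmx // mulNmx addrN aff_comp1.
Qed.

Lemma comp_aff (n : nat) (K : fieldType) (M : 'M[K]_n) b i : M \in unitmx ->
  component (aff M b) i = aff_comp M b i.
Proof. by move=> uM; rewrite /component affE // tnth_mktuple. Qed.

Lemma affM (n : nat) (K : fieldType) (M M' : 'M[K]_n) b b' :
  M \in unitmx -> M' \in unitmx ->
  (aff M b * aff M' b')%g = aff (M *m M') (M *m b' + b).
Proof.
move=> uM uM'; apply: GA_ext => i.
rewrite comp_GAM !comp_aff ?unitmx_mul ?uM //.
by rewrite affE // aff_comp_comp.
Qed.

Lemma aff1 (n : nat) (K : fieldType) : aff 1%:M (0 : 'cV[K]_n) = 1%g.
Proof.
by apply: GA_ext => i; rewrite comp_aff ?unitmx1 // aff_comp1 comp_GA1.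
Qed.

Lemma affV (n : nat) (K : fieldType) (M : 'M[K]_n) b : M \in unitmx ->
  (aff M b)^-1%g = aff (invmx M) (- invmx M *m b).
Proof.
move=> uM; apply: mulg1_eq; rewrite affM ?unitmx_inv // mulmxV //.
by rewrite mulNmx mulmxN mulmxA mulmxV // mul1mx addNr aff1.
Qed.

Lemma mdeg_lt2 n (m : 'X_{1..n}) :
  (mdeg m < 2)%N -> m = 0%MM \/ exists j, m = U_(j)%MM.
Proof.
case: (posnP (mdeg m)) => [/eqP|m0 m2]; first by rewrite mdeg_eq0 => /eqP; left.
have /eqP/mdeg1P [j /eqP ->] : mdeg m = 1%N by lia.
by right; exists j.
Qed.

Lemma msize_le2E (n : nat) (K : fieldType) (p : {mpoly K[n]}) :
  (msize p <= 2)%N -> p = \sum_j p@_U_(j) *: 'X_j + (p@_0)%:MP.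
Proof.
move=> p2; apply/mpolyP => m; rewrite mcoeffD mcoeffC raddf_sum /=.
under eq_bigr => j _ do rewrite mcoeffZ mcoeffX.
have [m2|m2] := leqP 2 (mdeg m).
  have /memN_msupp_eq0 -> : m \notin msupp p.
    by rewrite msize_mdeg_ge // (leq_trans p2).
  have -> : (m == 0%MM) = false by apply: contraTF m2 => /eqP->; rewrite mdeg0.
  rewrite mulr0 addr0 big1 // => j _.
  have -> : (U_(j)%MM == m) = false; last by rewrite mulr0.
  by apply: contraTF m2 => /eqP<-; rewrite mdeg1.
case: (mdeg_lt2 m2) => [->|[k ->]].
  rewrite eqxx mulr1 big1 ?add0r // => j _.
  have -> : (U_(j)%MM == 0%MM :> 'X_{1..n}) = false; last by rewrite mulr0.
  by rewrite mnm1_eq0.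
have -> : (U_(k)%MM == 0%MM :> 'X_{1..n}) = false by rewrite mnm1_eq0.
rewrite mulr0 addr0 (bigD1 k) //= eqxx mulr1 big1 ?addr0 // => j jk.
by rewrite eq_mnm1 (negPf jk) mulr0.
Qed.

Lemma aff_comp_coefU (n : nat) (K : fieldType) (M : 'M[K]_n) b i j :
  (aff_comp M b i)@_U_(j) = M i j.
Proof.
rewrite mcoeffD mcoeffC mnm1_eq0 mulr0 addr0 raddf_sum /= (bigD1 j) //=.
rewrite mcoeffZ mcoeffXU eqxx mulr1 big1 ?addr0 // => k kj.
by rewrite mcoeffZ mcoeffXU (negPf kj) mulr0.
Qed.

Lemma msize_aff_comp (n : nat) (K : fieldType) (M : 'M[K]_n) b i :
  (msize (aff_comp M b i) <= 2)%N.
Proof.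
rewrite (leq_trans (msizeD_le _ _)) // geq_max msizeC.
rewrite (leq_trans (leq_b1 _)) // andbT (leq_trans (msize_sum _ _ _)) //.
apply/bigmax_leqP => j _; rewrite (leq_trans (msizeZ_le _ _)) //.
by rewrite msizeX mdeg1.
Qed.

Lemma affine_aff (n : nat) (K : fieldType) (M : 'M[K]_n) b :
  M \in unitmx -> affine (aff M b).
Proof.
move=> uM i; rewrite comp_aff //; apply/eqP; rewrite eqn_leq msize_aff_comp /=.
have [j Mij] : exists j, M i j != 0.
  apply/existsP; apply: contraT => /existsPn Mi0.
  have /matrixP/(_ i i) := mulmxV uM; rewrite !mxE eqxx big1.
    by move/eqP; rewrite eq_sym oner_eq0.
  by move=> j _; move: (Mi0 j); rewrite negbK => /eqP->; rewrite mul0r.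
have : U_(j)%MM \in msupp (aff_comp M b i).
  by rewrite mcoeff_msupp aff_comp_coefU.
by move/msize_mdeg_lt; rewrite mdeg1.
Qed.

Definition jac0 (n : nat) (K : fieldType) (phi : GA n K) : 'M[K]_n :=
  \matrix_(i, j) (component phi i)@_U_(j).

Definition val0 (n : nat) (K : fieldType) (phi : GA n K) : 'cV[K]_n :=
  \col_i (component phi i)@_0.

(** As [phi] has degree at most one, the linear coefficients of [phi * phi^-1] are linear
    combinations of those of [phi^-1]; hence [jac0 phi *m jac0 phi^-1] is the identity, with no
    bound on the degree of [phi^-1]. *)
Lemma affine_le2P (n : nat) (K : fieldType) (phi : GA n K) :
  (forall i, (msize (component phi i) <= 2)%N) ->
  jac0 phi \in unitmx /\ phi = aff (jac0 phi) (val0 phi).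
Proof.
move=> a.
have e i : component phi i = aff_comp (jac0 phi) (val0 phi) i.
  rewrite [LHS]msize_le2E // /aff_comp mxE; congr (_ + _).
  by apply: eq_bigr => j _; rewrite mxE.
have uM : jac0 phi \in unitmx.
  suff /mulmx1_unit[] : jac0 phi *m jac0 phi^-1%g = 1%:M by [].
  apply/matrixP => i k; have := comp_GA1 K i; rewrite -(mulgV phi) comp_GAM e.
  move/(congr1 (mcoeff U_(k)%MM)); rewrite mcoeffXU !mxE => <-.
  rewrite /aff_comp raddfD /= comp_mpolyC raddf_sum /= mcoeffD mcoeffC mnm1_eq0.
  rewrite mulr0 addr0 raddf_sum /=; apply: eq_bigr => j _.
  by rewrite comp_mpolyZ pullX mcoeffZ !mxE.
by split=> //; apply: GA_ext => i; rewrite comp_aff.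
Qed.

Lemma affineP (n : nat) (K : fieldType) (phi : GA n K) :
  affine phi -> jac0 phi \in unitmx /\ phi = aff (jac0 phi) (val0 phi).
Proof. by move=> a; apply: affine_le2P => i; rewrite a. Qed.

Lemma affine_le2 (n : nat) (K : fieldType) (phi : GA n K) :
  (forall i, (msize (component phi i) <= 2)%N) -> affine phi.
Proof. by case/affine_le2P=> u ->; apply: affine_aff. Qed.

Lemma affine_mul (n : nat) (K : fieldType) (phi psi : GA n K) :
  affine phi -> affine psi -> affine (phi * psi)%g.
Proof.
case/affineP=> u -> /affineP[v ->].
by rewrite affM //; apply: affine_aff; rewrite unitmx_mul u.
Qed.

Lemma affine_inv (n : nat) (K : fieldType) (phi : GA n K) :
  affine phi -> affine (phi^-1)%g.
Proof.
by case/affineP=> u ->; rewrite affV //; apply: affine_aff; rewrite unitmx_inv.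
Qed.

Lemma affine1 (n : nat) (K : fieldType) : affine (1%g : GA n K).
Proof. by rewrite -aff1; apply: affine_aff; rewrite unitmx1. Qed.

Lemma mcoeff0_comp (n : nat) (K : fieldType) (t : n.-tuple {mpoly K[n]}) p :
  (p \mPo t)@_0 = p.@[fun i => (tnth t i)@_0].
Proof.
have e (q : {mpoly K[n]}) : q@_0 = q.@[fun=> 0].
  elim/mpolyind: q => [|c m q _ _ IH]; first by rewrite mcoeff0 meval0.
  rewrite mcoeffD mevalD IH mcoeffZ mevalZ mevalX mcoeffX; congr (_ * _ + _).
  case: eqP => [->|m0]; first by rewrite big1 // => i _; rewrite mnm0E expr0.
  have [i mi] : exists i, m i != 0%N.
    apply/existsP; apply: contraT => /existsPn m0'; case: m0.
    by apply/mnmP => i; rewrite mnm0E; move: (m0' i); rewrite negbK => /eqP.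
  by rewrite (bigD1 i) //= expr0n (negPf mi) mul0r.
by rewrite e comp_mpoly_meval; apply: meval_eq => i; rewrite e.
Qed.

(** * Characteristic zero and diagonal substitutions *)

Lemma natr_inj (K : fieldType) : [pchar K] =i pred0 ->
  injective (fun k : nat => k%:R : K).
Proof.
move=> /pcharf0P hK.
suff le k l : (k <= l)%N -> k%:R = l%:R :> K -> k = l.
  move=> k l e; case: (leqP k l) => [/le|/ltnW/le] h; first exact: h.
  by rewrite (h (esym e)).
move=> kl /eqP; rewrite eq_sym -subr_eq0 -natrB // hK subn_eq0 => lk.
by apply/eqP; rewrite eqn_leq kl.
Qed.

Lemma natr_neq0 (K : fieldType) : [pchar K] =i pred0 ->
  forall k, k.+1%:R != 0 :> K.
Proof. by move=> /pcharf0P hK k; rewrite hK. Qed.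

Lemma exp2r_inj (K : fieldType) : [pchar K] =i pred0 ->
  injective (fun k : nat => 2%:R ^+ k : K).
Proof.
move=> hK k l; rewrite -!natrX => /(natr_inj hK)/eqP.
by rewrite eqn_exp2l // => /eqP.
Qed.

Definition diag_tuple (n : nat) (K : fieldType) (d : 'I_n -> K) :
  n.-tuple {mpoly K[n]} := [tuple d i *: 'X_i | i < n].

Lemma tnth_diag (n : nat) (K : fieldType) (d : 'I_n -> K) i :
  tnth (diag_tuple d) i = d i *: 'X_i.
Proof. by rewrite tnth_mktuple. Qed.

Lemma mcoeff_diag (n : nat) (K : fieldType) (d : 'I_n -> K) p m :
  (p \mPo diag_tuple d)@_m = (\prod_i d i ^+ m i) * p@_m.
Proof.
elim/mpolyind: p => [|c m' q _ _ IH]; first by rewrite comp_mpoly0 !mcoeff0 mulr0.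
rewrite comp_mpolyD !mcoeffD IH mulrDr; congr (_ + _).
have -> : (c *: 'X_[m']) \mPo diag_tuple d
    = (c * \prod_i d i ^+ m' i) *: 'X_[m'].
  rewrite comp_mpolyZ comp_mpolyX -scalerA; congr (_ *: _).
  rewrite [X in _ *: X]mpolyXE_id -scaler_prod; apply: eq_bigr => i _.
  by rewrite tnth_diag exprZn.
rewrite !mcoeffZ mcoeffX.
by case: eqP => [->|]; rewrite ?mulr0 // !mulr1 mulrC.
Qed.

(* The substitution doubling one variable separates monomials, 2 having
   infinite order in K*. *)
Lemma monomial_mem (n : nat) (K : fieldType) (V : {mpoly K[n]} -> Prop) :
  [pchar K] =i pred0 ->
  (forall p q, V p -> V q -> V (p + q)) ->
  (forall c p, V p -> V (c *: p)) ->
  (forall i p, V p ->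
     V (p \mPo diag_tuple (fun j => if j == i then 2%:R else 1))) ->
  forall p m, V p -> m \in msupp p -> V 'X_[m].
Proof.
move=> hK VD VZ Vs p m; move: {2}(size _) (leqnn (size (msupp p))) => k.
elim: k p => [|k IH] p; first by rewrite leqn0 size_eq0 => /eqP->.
move=> szp Vp mp.
case: (boolP (all (pred1 m) (msupp p))) => [/allP pm|/allPn[/= m' m'p m'm]].
  rewrite -[V _]/(V _) (_ : 'X_[m] = (p@_m)^-1 *: p); first exact: VZ.
  apply/mpolyP => m'; rewrite mcoeffZ mcoeffX.
  case: (eqVneq m m') => [<-|mm']; first by rewrite mulVf // -mcoeff_msupp.
  rewrite (@memN_msupp_eq0 _ _ p m') ?mulr0 //; apply: contra mm' => /pm /=.
  by rewrite eq_sym.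
have [i mi] : exists i, m i != m' i.
  apply/existsP; apply: contraT => /existsPn h; case/eqP: m'm.
  by apply/mnmP => i; move: (h i); rewrite negbK => /eqP.
pose s := fun j => if j == i then 2%:R else 1 : K.
have sE l : \prod_j s j ^+ (l j) = 2%:R ^+ (l i).
  rewrite (bigD1 i) //= /s eqxx big1 ?mulr1 // => j ji.
  by rewrite (negPf ji) expr1n.
(* Subtracting the multiple that cancels the coefficient at [m'] shrinks the support. The
   coefficient at [m] survives, because [m] and [m'] differ at [i] and powers of 2 are distinct. *)
pose q := p \mPo diag_tuple s - 2%:R ^+ m' i *: p.
have qE l : q@_l = (2%:R ^+ l i - 2%:R ^+ m' i) * p@_l.
  by rewrite mcoeffB mcoeffZ mcoeff_diag sE mulrBl.
have Vq : V q by apply: VD; [apply: Vs | rewrite -scaleNr; apply: VZ].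
have sub : {subset msupp q <= rem m' (msupp p)}.
  move=> l; rewrite mcoeff_msupp qE mulf_eq0 negb_or subr_eq0 => /andP[h1 h2].
  rewrite mem_rem_uniq ?msupp_uniq // inE mcoeff_msupp h2 andbT.
  by apply: contra h1 => /eqP->.
apply: (IH q) => //; last first.
  rewrite mcoeff_msupp qE mulf_eq0 negb_or -mcoeff_msupp mp andbT subr_eq0.
  by apply: contra mi => /eqP/(exp2r_inj hK)->.
apply: leq_trans (uniq_leq_size (msupp_uniq _) sub) _.
by rewrite size_rem // -ltnS (leq_trans _ szp) // prednK //; case: msupp m'p.
Qed.

(** * Polynomials in a subset of the variables *)

(** Sets the variables outside [A] to zero. Being fixed by this ring morphism is the encoding of
    involving only variables of [A], so that stability under ring operations and substitution comes
    from morphism laws. *)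
Definition mask (n : nat) (K : fieldType) (A : pred 'I_n) :
  n.-tuple {mpoly K[n]} := [tuple if A i then 'X_i else 0 | i < n].

Lemma tnth_mask (n : nat) (K : fieldType) A i :
  tnth (mask (n := n) K A) i = if A i then 'X_i else 0.
Proof. by rewrite tnth_mktuple. Qed.

Lemma tnth_pcomp (n : nat) (K : fieldType) (t u : n.-tuple {mpoly K[n]}) i :
  tnth (Defs.pcomp t u) i = tnth t i \mPo u.
Proof. by rewrite tnth_mktuple. Qed.

(* p involves only the variables in A. *)
Definition over (n : nat) (K : fieldType) A (p : {mpoly K[n]}) :=
  p \mPo mask K A = p.

Lemma comp_maskX (n : nat) (K : fieldType) (A : pred 'I_n) (m : 'X_{1..n}) :
  'X_[m] \mPo mask K A
  = if [forall j : 'I_n, A j || (m j == 0%N)] then 'X_[m] else 0.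
Proof.
rewrite comp_mpolyX; case: forallP => [h|/forallP].
  rewrite [RHS]mpolyXE_id; apply: eq_bigr => j _; rewrite tnth_mask.
  by case: (A j) (h j) => //= /eqP->.
rewrite negb_forall => /existsP[j]; rewrite negb_or => /andP[kj mj].
by rewrite (bigD1 j) //= tnth_mask (negPf kj) expr0n (negPf mj) mul0r.
Qed.

Lemma overP (n : nat) (K : fieldType) A (p : {mpoly K[n]}) :
  over A p <-> (forall m, m \in msupp p -> forall j, ~~ A j -> m j = 0%N).
Proof.
split=> [e m|h].
  move=> mp j kj; apply/eqP; apply: contraTT mp => mj.
  rewrite -mcoeff_eq0 -e comp_mpolyEX raddf_sum /= big1 // => l _.
  rewrite mcoeffZ comp_maskX; case: forallP => [h|]; last first.
    by rewrite mcoeff0 mulr0.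
  rewrite mcoeffX; case: eqP => [lm|]; rewrite ?mulr0 //.
  by move: (h j) mj; rewrite -lm (negPf kj) => /= /eqP->.
rewrite /over comp_mpolyEX [RHS]mpolyE; apply: eq_big_seq => m mp.
rewrite comp_maskX; case: forallP => // h'.
case: h' => j; case: (boolP (A j)) => //= Aj; apply/eqP; exact: (h m).
Qed.

Lemma over_comp (n : nat) (K : fieldType) A B (p : {mpoly K[n]})
    (t : n.-tuple {mpoly K[n]}) :
  over A p -> (forall j, A j -> over B (tnth t j)) -> over B (p \mPo t).
Proof.
move=> pA tA; rewrite /over -{2}pA -{1}pA !comp_pcomp.
apply: (congr1 (fun u => p \mPo u)).
apply: eq_from_tnth => j; rewrite !(tnth_pcomp (mask K A)) tnth_mask.
by case: ifP => [jA|_]; rewrite ?comp_mpoly0 // !pullX tnth_pcomp tA.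
Qed.

Lemma eq_over_comp (n : nat) (K : fieldType) A (p : {mpoly K[n]})
    (t u : n.-tuple {mpoly K[n]}) :
  over A p -> (forall j, A j -> tnth t j = tnth u j) -> p \mPo t = p \mPo u.
Proof.
move=> pA tu; rewrite -pA !comp_pcomp.
apply: (congr1 (fun u => p \mPo u)).
apply: eq_from_tnth => j; rewrite !(tnth_pcomp (mask K A)) tnth_mask.
by case: ifP => [jA|_]; rewrite ?comp_mpoly0 // !pullX tu.
Qed.

Lemma over_comp_id (n : nat) (K : fieldType) A (p : {mpoly K[n]})
    (t : n.-tuple {mpoly K[n]}) :
  over A p -> (forall j, A j -> tnth t j = 'X_j) -> p \mPo t = p.
Proof.
move=> pA tX; rewrite (eq_over_comp (u := pid n K) pA) ?comp_mpoly_id // => j jA.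
by rewrite tX // tnth_mktuple.
Qed.

Lemma overX (n : nat) (K : fieldType) (A : pred 'I_n) i :
  A i -> over A ('X_i : {mpoly K[n]}).
Proof. by move=> iA; rewrite /over pullX tnth_mask iA. Qed.

Lemma overC (n : nat) (K : fieldType) (A : pred 'I_n) c :
  over A (c%:MP : {mpoly K[n]}).
Proof. by rewrite /over comp_mpolyC. Qed.

Lemma overD (n : nat) (K : fieldType) A (p q : {mpoly K[n]}) :
  over A p -> over A q -> over A (p + q).
Proof. by rewrite /over comp_mpolyD => -> ->. Qed.

Lemma overZ (n : nat) (K : fieldType) A c (p : {mpoly K[n]}) :
  over A p -> over A (c *: p).
Proof. by rewrite /over comp_mpolyZ => ->. Qed.

Lemma overN (n : nat) (K : fieldType) A (p : {mpoly K[n]}) :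
  over A p -> over A (- p).
Proof. by rewrite /over comp_mpolyN => ->. Qed.

Lemma overM (n : nat) (K : fieldType) A (p q : {mpoly K[n]}) :
  over A p -> over A q -> over A (p * q).
Proof. by rewrite /over rmorphM /= => -> ->. Qed.

Lemma overXn (n : nat) (K : fieldType) A k (p : {mpoly K[n]}) :
  over A p -> over A (p ^+ k).
Proof. by rewrite /over rmorphXn /= => ->. Qed.

Lemma sub_over (n : nat) (K : fieldType) (A B : pred 'I_n) (p : {mpoly K[n]}) :
  (forall j, A j -> B j) -> over A p -> over B p.
Proof.
move=> AB /overP h; apply/overP => m mp j jB; apply: (h m) => //.
by apply: contra jB; apply: AB.
Qed.

Definition low (n : nat) (K : fieldType) k (p : {mpoly K[n]}) :=
  over (fun j : 'I_n => (j < k)%N) p.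

Lemma lowP (n : nat) (K : fieldType) k (p : {mpoly K[n]}) :
  low k p <-> in_first_vars k p.
Proof.
split=> [/overP h m mp j kj|h].
  by apply: (h m) => //; rewrite -leqNgt.
by apply/overP => m mp j; rewrite -leqNgt; apply: h.
Qed.

(** * Elementary automorphisms *)

(** The map x_i -> x_i + p. If [p] involves x_i the second tuple need not be an inverse, and [mkGA]
    may fall back on the identity; hence the condition [over (other i) p] in what follows. *)
Definition elem (n : nat) (K : fieldType) : 'I_n -> {mpoly K[n]} -> GA n K :=
  locked_with (GA_key 1) (fun i p =>
    mkGA [tuple 'X_j + (if j == i then p else 0) | j < n]
         [tuple 'X_j - (if j == i then p else 0) | j < n]).

Definition other (n : nat) (i : 'I_n) : pred 'I_n := fun j => j != i.

Lemma elemE (n : nat) (K : fieldType) (i : 'I_n) (p : {mpoly K[n]}) :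
  over (other i) p ->
  GA_tuple (elem i p) = [tuple 'X_j + (if j == i then p else 0) | j < n].
Proof.
move=> hp; rewrite /elem unlock; apply: mkGAE => j; rewrite tnth_mktuple.
  rewrite comp_mpolyD pullX tnth_mktuple; case: ifP => ji.
    rewrite (over_comp_id hp) ?subrK // => k ki.
    by rewrite tnth_mktuple (negPf ki) subr0.
  by rewrite comp_mpoly0 addr0 subr0.
rewrite comp_mpolyB pullX tnth_mktuple; case: ifP => ji.
  rewrite (over_comp_id hp) ?addrK // => k ki.
  by rewrite tnth_mktuple (negPf ki) addr0.
by rewrite comp_mpoly0 addr0 subr0.
Qed.

Lemma comp_elem (n : nat) (K : fieldType) (i j : 'I_n) (p : {mpoly K[n]}) :
  over (other i) p ->
  component (elem i p) j = 'X_j + (if j == i then p else 0).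
Proof. by move=> hp; rewrite /component elemE // tnth_mktuple. Qed.

Lemma pull_elem (n : nat) (K : fieldType) (i : 'I_n) (p q : {mpoly K[n]}) :
  over (other i) p -> over (other i) q -> p \mPo GA_tuple (elem i q) = p.
Proof.
move=> hp hq; apply: (over_comp_id hp) => j ji.
by rewrite -/(component _ j) comp_elem // (negPf ji) addr0.
Qed.

Lemma elemD (n : nat) (K : fieldType) (i : 'I_n) (p q : {mpoly K[n]}) :
  over (other i) p -> over (other i) q ->
  elem i (p + q) = (elem i p * elem i q)%g.
Proof.
move=> hp hq; apply: GA_ext => j; rewrite comp_GAM !comp_elem //; last exact: overD.
rewrite comp_mpolyD pullX -/(component _ j) comp_elem // -addrA; congr (_ + _).
by case: ifP; rewrite ?comp_mpoly0 ?addr0 // pull_elem // addrC.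
Qed.

Lemma elem0 (n : nat) (K : fieldType) (i : 'I_n) : elem i 0 = 1%g :> GA n K.
Proof.
apply: GA_ext => j; rewrite comp_elem ?comp_GA1; last exact: comp_mpoly0.
by case: ifP; rewrite addr0.
Qed.

Lemma elemV (n : nat) (K : fieldType) (i : 'I_n) (p : {mpoly K[n]}) :
  over (other i) p -> (elem i p)^-1%g = elem i (- p).
Proof.
move=> hp; apply: mulg1_eq; rewrite -elemD ?subrr ?elem0 //; exact: overN.
Qed.

Lemma affine_elem (n : nat) (K : fieldType) (i : 'I_n) (p : {mpoly K[n]}) :
  over (other i) p -> (msize p <= 2)%N -> affine (elem i p).
Proof.
move=> hp p2; apply: affine_le2 => j; rewrite comp_elem //.
rewrite (leq_trans (msizeD_le _ _)) // geq_max msizeX mdeg1 /=.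
by case: ifP => //; rewrite msize0.
Qed.

(** Such a [beta] scales x_i and keeps x_i out of its other components, so it conjugates elementary
    automorphisms in direction [i] to elementary ones. The closure of [elem_mem] under scaling and
    substitution rests on this. *)
Lemma elem_conj (n : nat) (K : fieldType) (i : 'I_n) p c (beta : GA n K) :
  c != 0 -> over (other i) p -> component beta i = c *: 'X_i ->
  (forall j, j != i -> over (other i) (component beta j)) ->
  over (other i) (c^-1 *: (p \mPo GA_tuple beta)) /\
  (elem i p * beta = beta * elem i (c^-1 *: (p \mPo GA_tuple beta)))%g.
Proof.
move=> c0 hp bi bo.
have hq : over (other i) (c^-1 *: (p \mPo GA_tuple beta)).
  by apply: overZ; apply: over_comp hp _ => j ji; apply: bo.
split=> //; apply: GA_ext => j; rewrite !comp_GAM comp_elem // comp_mpolyD pullX.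
rewrite -/(component _ _); case: (eqVneq j i) => [->|ji].
  rewrite bi comp_mpolyZ pullX -/(component _ _) comp_elem // eqxx.
  by rewrite scalerDr scalerA divff // scale1r.
by rewrite comp_mpoly0 addr0 pull_elem //; apply: bo.
Qed.

(** * Groups containing the affine maps and their elementary members *)

Definition over_affine (n : nat) (K : fieldType) (G : GA n K -> Prop) : Prop :=
  [/\ forall phi, affine phi -> G phi,
      forall phi psi, G phi -> G psi -> G (phi * psi)%g
    & forall phi, G phi -> G (phi^-1)%g].

Definition dil (n : nat) (K : fieldType) : ('I_n -> K) -> GA n K :=
  locked_with (GA_key 2) (fun d =>
    mkGA (diag_tuple d) (diag_tuple (fun i => (d i)^-1))).

Lemma dilE (n : nat) (K : fieldType) (d : 'I_n -> K) :
  (forall i, d i != 0) -> GA_tuple (dil d) = diag_tuple d.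
Proof.
move=> d0; rewrite /dil unlock; apply: mkGAE => i;
  rewrite tnth_diag comp_mpolyZ pullX tnth_diag.
  by rewrite scalerA divff // scale1r.
by rewrite scalerA mulVf // scale1r.
Qed.

Lemma comp_dil (n : nat) (K : fieldType) (d : 'I_n -> K) i :
  (forall i, d i != 0) -> component (dil d) i = d i *: 'X_i.
Proof. by move=> d0; rewrite /component dilE // tnth_diag. Qed.

Lemma affine_dil (n : nat) (K : fieldType) (d : 'I_n -> K) :
  (forall i, d i != 0) -> affine (dil d).
Proof.
move=> d0; apply: affine_le2 => i; rewrite comp_dil //.
by rewrite (leq_trans (msizeZ_le _ _)) // msizeX mdeg1.
Qed.

Definition pmap (n : nat) (K : fieldType) : 'S_n -> GA n K :=
  locked_with (GA_key 3) (fun s : 'S_n =>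
    mkGA [tuple 'X_(s i) | i < n] [tuple 'X_((s^-1)%g i) | i < n]).

Lemma pmapE (n : nat) (K : fieldType) (s : 'S_n) :
  GA_tuple (pmap K s) = [tuple 'X_(s i) | i < n].
Proof.
rewrite /pmap unlock.
by apply: mkGAE => i; rewrite tnth_mktuple pullX tnth_mktuple ?permK ?permKV.
Qed.

Lemma comp_pmap (n : nat) (K : fieldType) (s : 'S_n) i :
  component (pmap K s) i = 'X_(s i).
Proof. by rewrite /component pmapE tnth_mktuple. Qed.

Lemma affine_pmap (n : nat) (K : fieldType) (s : 'S_n) : affine (pmap K s).
Proof. by move=> i; rewrite comp_pmap msizeX mdeg1. Qed.

Lemma over_pmap (n : nat) (K : fieldType) (s : 'S_n) i (p : {mpoly K[n]}) :
  over (other i) p -> over (other (s i)) (p \mPo GA_tuple (pmap K s)).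
Proof.
move=> hp; apply: over_comp hp _ => j ji.
rewrite -/(component _ j) comp_pmap; apply: overX.
by rewrite /other (inj_eq perm_inj).
Qed.

Lemma elem_pmap (n : nat) (K : fieldType) (s : 'S_n) i (p : {mpoly K[n]}) :
  over (other i) p ->
  (elem i p * pmap K s
   = pmap K s * elem (s i) (p \mPo GA_tuple (pmap K s)))%g.
Proof.
move=> hp; have hq := over_pmap s hp.
apply: GA_ext => j; rewrite comp_GAM (comp_elem j hp) comp_mpolyD pullX.
rewrite -/(component _ _) comp_pmap.
rewrite [RHS]comp_GAM comp_pmap pullX -/(component _ _) (comp_elem _ hq).
by rewrite (inj_eq perm_inj); case: ifP; rewrite ?comp_mpoly0.
Qed.

Lemma conj_mem (n : nat) (K : fieldType) (G : GA n K -> Prop) phi psi beta :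
  over_affine G -> G beta -> (phi * beta = beta * psi)%g -> G phi -> G psi.
Proof.
move=> [_ GM GV] Gb e Gp; rewrite -(mulKg beta psi) -e; exact/GM/GM/Gb/Gp/GV.
Qed.

Definition elem_mem (n : nat) (K : fieldType) (G : GA n K -> Prop) i p :=
  over (other i) p /\ G (elem i p).

Lemma elem_memD (n : nat) (K : fieldType) (G : GA n K -> Prop) i p q :
  over_affine G -> elem_mem G i p -> elem_mem G i q -> elem_mem G i (p + q).
Proof.
move=> [_ GM _] [hp Gp] [hq Gq]; split; first exact: overD.
by rewrite elemD //; apply: GM.
Qed.

Lemma elem_mem_affine (n : nat) (K : fieldType) (G : GA n K -> Prop) i p :
  over_affine G -> over (other i) p -> (msize p <= 2)%N -> elem_mem G i p.
Proof. by move=> [GA _ _] hp p2; split=> //; apply/GA/affine_elem. Qed.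

Lemma elem_mem_conj (n : nat) (K : fieldType) (G : GA n K -> Prop) i p c beta :
  over_affine G -> G beta -> c != 0 -> component beta i = c *: 'X_i ->
  (forall j, j != i -> over (other i) (component beta j)) ->
  elem_mem G i p -> elem_mem G i (c^-1 *: (p \mPo GA_tuple beta)).
Proof.
move=> hG Gb c0 bi bo [hp Gp]; have [hq e] := elem_conj c0 hp bi bo.
by split=> //; apply: conj_mem e Gp.
Qed.

Lemma elem_mem_conj1 (n : nat) (K : fieldType) (G : GA n K -> Prop) i p beta :
  over_affine G -> G beta -> component beta i = 'X_i ->
  (forall j, j != i -> over (other i) (component beta j)) ->
  elem_mem G i p -> elem_mem G i (p \mPo GA_tuple beta).
Proof.
move=> hG Gb bi bo Gp; rewrite -[_ \mPo _]scale1r -[X in X *: _]invr1.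
by apply: elem_mem_conj; rewrite ?oner_neq0 ?scale1r.
Qed.

Lemma over_otherX (n : nat) (K : fieldType) (i j : 'I_n) :
  j != i -> over (other i) ('X_j : {mpoly K[n]}).
Proof. exact: overX. Qed.

Lemma elem_memZ (n : nat) (K : fieldType) (G : GA n K -> Prop) i p c :
  over_affine G -> elem_mem G i p -> elem_mem G i (c *: p).
Proof.
move=> hG Gp; have [->|c0] := eqVneq c 0.
  rewrite scale0r; apply: elem_mem_affine; rewrite ?msize0 //.
  by rewrite -mpolyC0; apply: overC.
pose d j := if j == i then c^-1 else 1.
have d0 j : d j != 0 by rewrite /d; case: ifP; rewrite ?oner_eq0 ?invr_neq0.
have hp := Gp.1; have := @elem_mem_conj _ _ G i p c^-1 (dil d) hG.
rewrite invrK (over_comp_id hp); last first.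
  by move=> j ji; rewrite dilE // tnth_diag /d (negPf ji) scale1r.
apply=> //; [| by rewrite invr_neq0 | |].
- by case: hG => GA _ _; apply/GA/affine_dil.
- by rewrite comp_dil // /d eqxx.
by move=> j ji; rewrite comp_dil //; apply/overZ/over_otherX.
Qed.

(** The polynomials [p] with [elem i p] in G form a space stable under doubling one variable:
    doubling x_i does not affect them, and doubling another variable is conjugation by a dilation.
    So [monomial_mem] applies. *)
Lemma elem_mem_monomial (n : nat) (K : fieldType) (G : GA n K -> Prop) i p m :
  [pchar K] =i pred0 -> over_affine G ->
  elem_mem G i p -> m \in msupp p -> elem_mem G i 'X_[m].
Proof.
move=> hK hG; apply: (monomial_mem hK (V := elem_mem G i)).
- by move=> q r; apply: elem_memD.
- by move=> c q; apply: elem_memZ.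
move=> k q Gq; have hq := Gq.1.
have [->|ki] := eqVneq k i.
  rewrite (over_comp_id hq) // => j ji.
  by rewrite tnth_diag (negPf ji) scale1r.
pose d j := if j == k then 2%:R else 1 : K.
have d0 j : d j != 0 by rewrite /d; case: ifP; rewrite ?oner_eq0 ?(natr_neq0 hK).
rewrite -(dilE d0); apply: elem_mem_conj1 => //.
- by case: hG => GA _ _; apply/GA/affine_dil.
- by rewrite comp_dil // /d eq_sym (negPf ki) scale1r.
by move=> j ji; rewrite comp_dil //; apply/overZ/over_otherX.
Qed.

Lemma mcoeff_mask (n : nat) (K : fieldType) (A : pred 'I_n) (p : {mpoly K[n]})
    (m : 'X_{1..n}) :
  (forall j, ~~ A j -> m j = 0%N) -> (p \mPo mask K A)@_m = p@_m.
Proof.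
move=> hm; rewrite comp_mpolyEX raddf_sum [in RHS](mpolyE p) raddf_sum /=.
apply: eq_bigr => l _; rewrite !mcoeffZ comp_maskX.
case: forallP => // h; rewrite mcoeff0 mcoeffX.
case: eqP => // lm; case: h => j; rewrite lm.
by case: (boolP (A j)) => //= /hm->.
Qed.

(** * Generating the tame group of affine 3-space *)


Lemma ord3_ind (P : 'I_3 -> Prop) : P i0 -> P i1 -> P i2 -> forall i, P i.
Proof.
by move=> p0 p1 p2 [[|[|[|k]]] h] //; [move: p0|move: p1|move: p2];
  congr P; apply: val_inj.
Qed.

Lemma sum3 (V : nmodType) (F : 'I_3 -> V) : \sum_i F i = F i0 + F i1 + F i2.
Proof.
rewrite !big_ord_recl big_ord0 addr0 addrA.
by congr (F _ + F _ + F _); apply: val_inj.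
Qed.

Lemma prod3 (R : comNzRingType) (F : 'I_3 -> R) :
  \prod_i F i = F i0 * F i1 * F i2.
Proof.
rewrite !big_ord_recl big_ord0 mulr1 mulrA.
by congr (F _ * F _ * F _); apply: val_inj.
Qed.

Lemma elem_mem_subst (K : fieldType) (G : GA 3 K -> Prop) i p q :
  over_affine G -> i != i2 -> over (other i) q -> over (other i2) q ->
  G (elem i q) -> elem_mem G i2 p ->
  elem_mem G i2 (p \mPo [tuple 'X_j + (if j == i then q else 0) | j < 3]).
Proof.
move=> hG ii hq hq2 Gq Gp; rewrite -elemE //.
apply: elem_mem_conj1 => // [|j j2]; rewrite comp_elem //.
  by rewrite eq_sym (negPf ii) addr0.
apply: overD; first exact: over_otherX.
by case: ifP => // _; rewrite -mpolyC0; apply: overC.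
Qed.

Lemma mcoeff_exprD (n : nat) (K : fieldType) (i j : 'I_n) a b : i != j ->
  (('X_i + 'X_j : {mpoly K[n]}) ^+ (a + b))@_(U_(i) *+ a + U_(j) *+ b)
  = 'C(a + b, b)%:R.
Proof.
move=> ij; rewrite exprDn raddf_sum /=.
rewrite (bigD1 (Ordinal (leq_addl a b : (b < (a + b).+1)%N))) //=.
rewrite addnK !mpolyXn -mpolyXD mcoeffMn mcoeffX eqxx big1 ?addr0 // => k kb.
rewrite !mpolyXn -mpolyXD mcoeffMn mcoeffX; case: eqP => [e|_]; last first.
  by rewrite mul0rn.
case/eqP: kb; apply: val_inj; move/mnmP/(_ j): e.
by rewrite !mnmDE !mulmnE !mnm1E (negPf ij) eqxx !mul0n !mul1n !add0n.
Qed.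

(** Start from a monomial x0^a x1^b of degree n >= 2. Substituting x0 + x1 for x0 produces x1^n, and
    substituting x1 + 1 for x1 then produces x1^2, with coefficient binomial(n, 2), nonzero in
    characteristic zero. *)
Lemma elem_mem_sq (K : fieldType) (G : GA 3 K -> Prop) p :
  [pchar K] =i pred0 -> over_affine G -> elem_mem G i2 p -> (2 < msize p)%N ->
  elem_mem G i2 ('X_i1 ^+ 2).
Proof.
move=> hK hG Gp p2.
have [m mp m2] : exists2 m, m \in msupp p & (2 <= mdeg m)%N.
  apply/hasP; apply: contraTT p2 => /hasPn h; rewrite -leqNgt msizeE.
  by apply/bigmax_leqP_seq => m mp _; rewrite ltnNge h.
have := elem_mem_monomial hK hG Gp mp.
have m20 : m i2 = 0%N by have /overP h := Gp.1; apply: (h m).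
move: m2; rewrite mpolyXE_id prod3 m20 expr0 mulr1 mdegE sum3 m20 addr0.
rewrite -[(m i0 + m i1)%R]/(m i0 + m i1)%N.
move: (m i0) (m i1) => a b ab Gab.
have Gn : elem_mem G i2 ('X_i1 ^+ (a + b)).
  have /(_ _) Gc := elem_mem_subst (i := i0) (q := 'X_i1) hG isT _ _ _ Gab.
  rewrite mpolyXn; apply: (elem_mem_monomial hK hG (Gc _ _ _)).
  - exact: over_otherX.
  - exact: over_otherX.
  - by case: hG => GA _ _; apply/GA/affine_elem; rewrite ?msizeX ?mdeg1 //;
       apply: over_otherX.
  rewrite mcoeff_msupp -(@mcoeff_mask _ _ (pred1 i1)) => [|j /= ji]; last first.
    by rewrite mulmnE mnm1E eq_sym (negPf ji).
  rewrite comp_pcomp rmorphM /= !(rmorphXn (comp_mpoly _)) /= !pullX !tnth_pcomp.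
  rewrite !tnth_mktuple /= !comp_mpolyD !pullX !tnth_mask /= comp_mpoly0.
  by rewrite add0r addr0 -exprD mpolyXn mcoeffX eqxx oner_neq0.
move: (a + b)%N ab Gn => n n2 Gn.
have Gc := elem_mem_subst (i := i1) (q := 1) hG isT _ _ _ Gn.
rewrite mpolyXn; apply: (elem_mem_monomial hK hG (Gc _ _ _)).
- by rewrite -mpolyC1; apply: overC.
- by rewrite -mpolyC1; apply: overC.
- case: hG => GA _ _; apply/GA/affine_elem; rewrite ?msize1 //.
  by rewrite -mpolyC1; apply: overC.
rewrite rmorphXn /= pullX tnth_mktuple /= addrC exprDn mcoeff_msupp.
rewrite raddf_sum /= (bigD1 (Ordinal (n2 : (2 < n.+1)%N))) //=.
rewrite expr1n mul1r mpolyXn mcoeffMn mcoeffX eqxx big1 => [|k k2].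
  by rewrite addr0; have /pcharf0P -> := hK; rewrite -lt0n bin_gt0.
rewrite expr1n mul1r mpolyXn mcoeffMn mcoeffX; case: eqP => [e|_].
  case/eqP: k2; apply: val_inj; move/mnmP/(_ i1): e.
  by rewrite !mulmnE mnm1E eqxx !mul1n.
by rewrite mul0rn.
Qed.

(** From x1^2 the substitution x1 -> x1 + x0 yields x0 x1. Once x0^k is reached, exchanging x1 and
    x2 allows x1 -> x1 + x0^k, which turns x0 x1 into x0 x1 + x0^(k+1); so all powers of x0 are
    reached. Expanding (x0 + x1)^d gives every monomial of degree d, and transpositions give the
    other directions. *)
Lemma elem_mem_all (K : fieldType) (G : GA 3 K -> Prop) p :
  [pchar K] =i pred0 -> over_affine G -> elem_mem G i2 p -> (2 < msize p)%N ->
  forall i q, over (other i) q -> G (elem i q).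
Proof.
move=> hK hG Gp p2; have Gsq := elem_mem_sq hK hG Gp p2.
have GA_ := hG; case: GA_ => GA GM GV.
have oX i j : j != i -> over (other i) ('X_j : {mpoly K[3]}).
  exact: over_otherX.
have aff_elem i j : j != i -> G (elem i 'X_j).
  by move=> ij; apply/GA/affine_elem; rewrite ?msizeX ?mdeg1 //; apply: oX.
have G01 : elem_mem G i2 ('X_i0 * 'X_i1).
  have := elem_mem_subst (i := i1) (q := 'X_i0) hG isT (oX i1 i0 isT)
    (oX i2 i0 isT) (aff_elem i1 i0 isT) Gsq.
  rewrite rmorphXn /= pullX tnth_mktuple /= => Gs.
  rewrite -mpolyXD; apply: (elem_mem_monomial hK hG Gs).
  rewrite mcoeff_msupp addmC.
  have := @mcoeff_exprD 3 K i1 i0 1 1 isT; rewrite !mulm1n => ->.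
  exact: (natr_neq0 hK).
have G0 k : (0 < k)%N -> elem_mem G i2 ('X_i0 ^+ k).
  elim: k => // [[|k]] IH _.
    by split; [exact: oX | exact: aff_elem].
  have hk i : i != i0 -> over (other i) ('X_i0 ^+ k.+1 : {mpoly K[3]}).
    by move=> ii; apply/overXn/oX; rewrite eq_sym.
  have Ge : G (elem i1 ('X_i0 ^+ k.+1)).
    have := elem_pmap (tperm i1 i2) (IH isT).1.
    rewrite tpermR rmorphXn /= pullX -/(component _ _) comp_pmap tpermD // => e.
    by apply: conj_mem hG _ e (IH isT).2; apply/GA/affine_pmap.
  have := elem_mem_subst (i := i1) hG isT (hk i1 isT) (hk i2 isT) Ge G01.
  rewrite rmorphM /= !pullX !tnth_mktuple /= addr0 mulrDr -exprS => Gs.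
  rewrite -['X_i0 ^+ _](addKr ('X_i0 * 'X_i1)); apply: elem_memD => //.
  by rewrite -scaleN1r; apply: elem_memZ.
have G2 q : over (other i2) q -> elem_mem G i2 q.
  move=> hq; rewrite (mpolyE q) big_seq; elim/big_ind: _ => [|u v|m mq].
  - by split; [rewrite -mpolyC0; apply: overC | rewrite elem0; apply/GA/affine1].
  - exact: elem_memD.
  apply: elem_memZ => //; have m20 : m i2 = 0%N by have /overP h := hq; apply: (h m).
  have [m1|m1] := leqP (mdeg m) 1.
    apply: elem_mem_affine; rewrite ?msizeX //; apply/overP => l.
    by rewrite msuppX inE => /eqP-> j; rewrite negbK => /eqP->.
  have Gs := elem_mem_subst (i := i0) hG isT (oX i0 i1 isT) (oX i2 i1 isT)
    (aff_elem i0 i1 isT) (G0 _ (ltnW m1)).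
  apply: (elem_mem_monomial hK hG Gs).
  rewrite rmorphXn /= pullX tnth_mktuple /= mcoeff_msupp.
  have -> : m = (U_(i0) *+ m i0 + U_(i1) *+ m i1)%MM.
    apply/mnmP; elim/ord3_ind; rewrite mnmDE !mulmnE !mnm1E /= ?mul1n ?mul0n //.
    by rewrite addn0.
  rewrite mdegD !mdegMn !mdeg1 !mul1n mcoeff_exprD //.
  by have /pcharf0P -> := hK; rewrite -lt0n bin_gt0 leq_addl.
move=> i q hq; have := elem_pmap (tperm i i2) hq.
rewrite tpermL => e; have := over_pmap (tperm i i2) hq; rewrite tpermL => /G2[_ Gq].
set s := pmap K _ in e *.
have -> : elem i q = (s * elem i2 (q \mPo GA_tuple s) * s^-1)%g.
  by rewrite -e mulgK.
by apply: (GM); [apply: (GM) | apply: (GV)] => //; apply/GA/affine_pmap.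
Qed.

(** A triangular automorphism is a dilation times elementary automorphisms in directions 0, 1, 2:
    the polynomial added in direction i involves only variables that the factors further right leave
    fixed. *)
Lemma tame_of_elem (K : fieldType) (G : GA 3 K -> Prop) :
  over_affine G -> (forall i q, over (other i) q -> G (elem i q)) ->
  forall psi, tame psi -> G psi.
Proof.
move=> [GA GM GV] Ge psi; elim=> {psi} [psi [/GA//|]||x y _ Gx _ Gy|x _ Gx].
- case=> u [P h]; have u0 i : u i != 0 by case: (h i).
  have hP (i : 'I_3) : low i (P i) by apply/lowP; case: (h i).
  pose p i := (u i)^-1 *: P i.
  have hp (i : 'I_3) : low i (p i) by exact/overZ/hP.
  have hq i : over (other i) (p i).
    apply: sub_over (hp i) => j; rewrite /other => ji.
    by rewrite -val_eqE /= neq_ltn ji.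
  suff -> : psi = (dil u * (elem i0 (p i0) * (elem i1 (p i1) * elem i2 (p i2))))%g.
    by do !apply: (GM); try exact: Ge; apply/GA/affine_dil.
  apply: GA_ext => i; have [_ _ ->] := h i.
  rewrite comp_GAM comp_dil // comp_mpolyZ pullX -/(component _ _).
  have -> : u i *: 'X_i + P i = u i *: ('X_i + p i).
    by rewrite scalerDr scalerA divff // scale1r.
  have lowE k (j : 'I_3) (q r : {mpoly K[3]}) :
      over (other j) q -> (k <= j)%N -> low k r ->
      r \mPo GA_tuple (elem j q) = r.
    move=> hq' kj hr; apply: (over_comp_id hr) => l lk.
    rewrite -/(component _ l) comp_elem //.
    have -> : (l == j) = false; last by rewrite addr0.
    by apply/negP => /eqP e; move: lk; rewrite e ltnNge kj.
  congr (_ *: _); rewrite comp_GAM comp_elem // comp_mpolyD pullX pullM.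
  rewrite -/(component _ _) comp_GAM comp_elem // comp_mpolyD pullX.
  rewrite -/(component _ _) comp_elem //.
  elim/ord3_ind: i; rewrite /= ?comp_mpoly0 ?add0r ?addr0 //.
  - rewrite (lowE 0%N i1 _ _ (hq _) isT (hp i0)).
    by rewrite (lowE 0%N i2 _ _ (hq _) isT (hp i0)).
  - by rewrite (lowE 1%N i2 _ _ (hq _) isT (hp i1)).
- exact/GA/affine1.
- exact: GM.
exact: GV.
Qed.

(** * Translation degenerate automorphisms *)

Lemma over1 (n : nat) (K : fieldType) A : over A (1 : {mpoly K[n]}).
Proof. by rewrite -mpolyC1; apply: overC. Qed.

(** Invariance under one shift gives invariance under all shifts by naturals, a property stable
    under doubling variables because doubling x_i turns the shift by k into the shift by 2k. So each
    monomial of [p] is invariant; at x_i = 0 a monomial containing x_i vanishes, whereas its shift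
    does not. *)
Lemma over_of_shift (n : nat) (K : fieldType) (i : 'I_n) (p : {mpoly K[n]}) :
  [pchar K] =i pred0 -> p \mPo GA_tuple (elem i 1) = p -> over (other i) p.
Proof.
move=> hK p1; have o k : over (other i) (k%:R : {mpoly K[n]}).
  by rewrite -mpolyC_nat; apply: overC.
pose V (q : {mpoly K[n]}) := forall k, q \mPo GA_tuple (elem i k%:R) = q.
have Vp : V p.
  elim=> [|k IH]; first by rewrite elem0 pull1.
  by rewrite -addn1 natrD elemD ?pullM ?IH //; apply: over1.
apply/overP => m mp j; rewrite negbK => /eqP->{j}.
have /(_ 1%N) : V 'X_[m].
  apply: (monomial_mem hK (V := V)) Vp mp => [q r Vq Vr k|c q Vq k|j q Vq k].
  - by rewrite comp_mpolyD Vq Vr.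
  - by rewrite comp_mpolyZ Vq.
  pose d l := if l == j then 2%:R else 1 : K.
  have d0 l : d l != 0 by rewrite /d; case: ifP; rewrite ?oner_neq0 ?(natr_neq0 hK).
  rewrite -(dilE d0) -pullM.
  have -> : (dil d * elem i k%:R = elem i (if i == j then k.*2 else k)%:R * dil d)%g.
    apply: GA_ext => l; rewrite comp_GAM comp_dil // comp_mpolyZ pullX.
    rewrite -/(component _ _) comp_elem // comp_GAM comp_elem // comp_mpolyD.
    rewrite pullX -/(component _ _) comp_dil // scalerDr; congr (_ + _).
    case: ifP => [/eqP->|_]; last by rewrite comp_mpoly0 scaler0.
    rewrite rmorph_nat /d; case: ifP => _; last by rewrite scale1r.
    by rewrite scaler_nat -mulrnA muln2.
  by rewrite pullM Vq.
move/(congr1 (comp_mpoly (mask K (other i)))); rewrite comp_maskX.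
case: forallP => [h _|_]; first by have := h i; rewrite /other eqxx => /= /eqP.
rewrite comp_pcomp comp_mpolyX => /eqP; rewrite prodf_seq_eq0 => /hasP[j _ /=].
rewrite expf_eq0 => /andP[_]; rewrite tnth_pcomp -/(component _ _).
rewrite comp_elem; last exact: over1.
rewrite comp_mpolyD pullX tnth_mask /other; case: (eqVneq j i) => _.
  by rewrite comp_mpoly1 add0r oner_eq0.
by rewrite comp_mpoly0 addr0 -msize_poly_eq0 msizeX.
Qed.

(** The first two components of [psi] are free of x2 and the third is c (x2 + q) with q free of x2.
    Conjugating x2 -> x2 + x_i by [psi] puts the first two components, up to scaling, into
    elementary members of G. If these two are affine, then so is [psi * elem i2 (- q)], which puts
    [elem i2 (- q)] in G. *)
Lemma translation_degenerate (K : fieldType) (G : GA 3 K -> Prop) psi c :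
  [pchar K] =i pred0 -> over_affine G -> G psi -> c != 0 ->
  (forall i, component psi i \mPo GA_tuple (elem i2 1)
     = component psi i + (if i == i2 then c%:MP else 0)) ->
  affine psi \/ forall xi, tame xi -> G xi.
Proof.
move=> hK hG Gpsi c0 h.
have o i : i != i2 -> over (other i2) (component psi i).
  by move=> ii; apply: (over_of_shift hK); rewrite h (negPf ii) addr0.
pose q := c^-1 *: component psi i2 - 'X_i2.
have oq : over (other i2) q.
  apply: (over_of_shift hK); rewrite comp_mpolyB comp_mpolyZ h eqxx pullX.
  rewrite -/(component _ _) comp_elem; last exact: over1.
  rewrite eqxx scalerDr /q -[_ *: c%:MP]mul_mpolyC -mpolyCM mulVf // opprD.
  by rewrite addrACA subrr addr0.
have psi2 : component psi i2 = c *: ('X_i2 + q).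
  by rewrite /q addrC subrK scalerA divff // scale1r.
have Ge p : elem_mem G i2 p -> (2 < msize p)%N -> forall xi, tame xi -> G xi.
  by move=> Gp p2; apply: (tame_of_elem hG); apply: (elem_mem_all hK hG Gp p2).
have Gi i : i != i2 -> elem_mem G i2 (c^-1 *: component psi i).
  move=> ii; have oi : over (other i2) (c^-1 *: component psi i).
    by apply: overZ; apply: o.
  split=> //; have oX : over (other i2) ('X_i : {mpoly K[3]}).
    exact: over_otherX.
  apply: (conj_mem (phi := elem i2 'X_i) hG Gpsi); last first.
    by case: hG => GAf _ _; apply/GAf/affine_elem; rewrite ?msizeX ?mdeg1.
  apply: GA_ext => j; rewrite !comp_GAM comp_elem // comp_mpolyD pullX.
  rewrite -/(component _ _); case: (eqVneq j i2) => [->|ji].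
    rewrite psi2 comp_mpolyZ comp_mpolyD (pull_elem oq) // !pullX.
    rewrite -!/(component _ _) comp_elem // eqxx addrAC [in RHS]scalerDr.
    by rewrite scalerA divff // scale1r.
  by rewrite comp_mpoly0 addr0 pull_elem //; apply: o.
have sz i : (msize (c^-1 *: component psi i) = msize (component psi i))%N.
  by rewrite msizeZ ?invr_neq0.
have [h0|h0] := ltnP 2 (msize (component psi i0)).
  by right; apply: Ge (Gi i0 isT) _; rewrite sz.
have [h1|h1] := ltnP 2 (msize (component psi i1)).
  by right; apply: Ge (Gi i1 isT) _; rewrite sz.
have [hq|hq] := ltnP 2 (msize q).
  right; apply: (Ge (- q)); last by rewrite msizeN.
  split; first exact: overN.
  case: hG => GAf GM GV; rewrite -(mulKg psi (elem i2 (- q))).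
  apply: (GM); first exact: GV.
  apply/GAf/affine_le2 => i; rewrite comp_GAM.
  case: (eqVneq i i2) => [->|ii].
    rewrite psi2 comp_mpolyZ comp_mpolyD (pull_elem oq); last exact: overN.
    rewrite pullX -/(component _ _) comp_elem; last exact: overN.
    by rewrite eqxx subrK msizeZ // msizeX mdeg1.
  rewrite pull_elem //; [| exact: o | exact: overN].
  by elim/ord3_ind: i ii.
left; apply: affine_le2; apply: ord3_ind => //.
rewrite psi2 msizeZ // (leq_trans (msizeD_le _ _)) // geq_max hq andbT.
by rewrite msizeX mdeg1.
Qed.

(** * Differences along a translation *)

Definition tran (n : nat) (K : fieldType) (w : 'cV[K]_n) := aff 1%:M w.

Lemma affine_tran (n : nat) (K : fieldType) (w : 'cV[K]_n) : affine (tran w).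
Proof. by apply: affine_aff; apply: unitmx1. Qed.

Lemma comp_tran (n : nat) (K : fieldType) (w : 'cV[K]_n) i :
  component (tran w) i = 'X_i + (w i 0)%:MP.
Proof.
rewrite comp_aff ?unitmx1 // -(aff_comp1 K i) /aff_comp mxE mpolyC0 addr0.
by [].
Qed.

Definition diff (n : nat) (K : fieldType) (w : 'cV[K]_n) (p : {mpoly K[n]}) :=
  p \mPo GA_tuple (tran w) - p.

Lemma diffD (n : nat) (K : fieldType) (w : 'cV[K]_n) :
  {morph diff w : p q / p + q}.
Proof. by move=> p q; rewrite /diff comp_mpolyD opprD addrACA. Qed.

Lemma diffZ (n : nat) (K : fieldType) (w : 'cV[K]_n) c p :
  diff w (c *: p) = c *: diff w p.
Proof. by rewrite /diff comp_mpolyZ scalerBr. Qed.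

Lemma diffC (n : nat) (K : fieldType) (w : 'cV[K]_n) c : diff w c%:MP = 0.
Proof. by rewrite /diff comp_mpolyC subrr. Qed.

Lemma diff0 (n : nat) (K : fieldType) (w : 'cV[K]_n) : diff w 0 = 0.
Proof. by rewrite -mpolyC0 diffC. Qed.

Lemma iter_diffD (n : nat) (K : fieldType) (w : 'cV[K]_n) k :
  {morph iter k (diff w) : p q / p + q}.
Proof. by elim: k => // k IH p q; rewrite !iterS IH diffD. Qed.

Lemma iter_diffZ (n : nat) (K : fieldType) (w : 'cV[K]_n) k c p :
  iter k (diff w) (c *: p) = c *: iter k (diff w) p.
Proof. by elim: k => //= k IH; rewrite IH diffZ. Qed.

Lemma iter_diff0 (n : nat) (K : fieldType) (w : 'cV[K]_n) k :
  iter k (diff w) 0 = 0.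
Proof. by elim: k => //= k IH; rewrite IH diff0. Qed.

Lemma iter_diff_tran (n : nat) (K : fieldType) (w : 'cV[K]_n) k p :
  iter k (diff w) (p \mPo GA_tuple (tran w))
  = iter k (diff w) p \mPo GA_tuple (tran w).
Proof. by elim: k => //= k IH; rewrite IH /diff comp_mpolyB. Qed.

Lemma iter_diff_le (n : nat) (K : fieldType) (w : 'cV[K]_n) k l p :
  (k <= l)%N -> iter k (diff w) p = 0 -> iter l (diff w) p = 0.
Proof. by move=> kl e; rewrite -(subnK kl) iterD e iter_diff0. Qed.

(** By the product rule, the difference of x_i p is x_i times the difference of p plus w_i times the
    translate of p. Differences commute with the translation, so a factor x_i costs one more
    difference. *)
Lemma iter_diffX (n : nat) (K : fieldType) (w : 'cV[K]_n) i k p :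
  iter k (diff w) p = 0 -> iter k.+1 (diff w) ('X_i * p) = 0.
Proof.
elim: k p => [|k IH] p; first by move=> /= ->; rewrite mulr0 diff0.
rewrite iterSr => h; rewrite iterSr.
have -> : diff w ('X_i * p)
    = 'X_i * diff w p + w i 0 *: (p \mPo GA_tuple (tran w)).
  rewrite /diff rmorphM /= pullX -/(component _ _) comp_tran -mul_mpolyC; ring.
rewrite iter_diffD IH // iter_diffZ iter_diff_tran.
by rewrite -iterSr in h; rewrite h comp_mpoly0 scaler0 addr0.
Qed.

Lemma diff_nilpotent (n : nat) (K : fieldType) (w : 'cV[K]_n) p :
  exists k, iter k (diff w) p = 0.
Proof.
elim/mpolyind: p => [|c m p _ _ [k hk]]; first by exists 0%N.
suff [l hl] : exists l, iter l (diff w) 'X_[m] = 0.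
  exists (maxn k l); rewrite iter_diffD iter_diffZ.
  rewrite (iter_diff_le _ hk) ?leq_maxl // (iter_diff_le _ hl) ?leq_maxr //.
  by rewrite scaler0 addr0.
rewrite mpolyXE_id; elim/big_rec: _ => [|i q _ [l hl]].
  by exists 1%N; rewrite /= -mpolyC1 diffC.
elim: (m i) => [|j [r hr]]; first by exists l; rewrite expr0 mul1r.
by exists r.+1; rewrite exprS -mulrA; apply: iter_diffX.
Qed.

(** * Unipotent affine maps of 3-space without fixed points *)

Definition rows3 (K : fieldType) (r0 r1 r2 : 'rV[K]_3) : 'M[K]_3 :=
  \matrix_(i < 3) tnth [tuple r0; r1; r2] i.

Lemma mul_rows3 (K : fieldType) (u r0 r1 r2 : 'rV[K]_3) :
  u *m rows3 r0 r1 r2 = u 0 i0 *: r0 + u 0 i1 *: r1 + u 0 i2 *: r2.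
Proof. by rewrite mulmx_sum_row sum3 !rowK. Qed.

Lemma rows3_unit (K : fieldType) (r0 r1 r2 : 'rV[K]_3) :
  (forall x y z, x *: r0 + y *: r1 + z *: r2 = 0 -> [/\ x = 0, y = 0 & z = 0]) ->
  rows3 r0 r1 r2 \in unitmx.
Proof.
move=> h; rewrite -row_free_unit; apply: inj_row_free => u.
rewrite mul_rows3 => /h[e0 e1 e2]; apply/rowP.
by apply: ord3_ind; rewrite mxE.
Qed.

Lemma rows3_span (K : fieldType) (r0 r1 r2 u : 'rV[K]_3) :
  rows3 r0 r1 r2 \in unitmx ->
  exists x y z, u = x *: r0 + y *: r1 + z *: r2.
Proof.
move=> uQ; rewrite -[u](mulmxKV uQ) mul_rows3; set v := u *m _.
by exists (v 0 i0), (v 0 i1), (v 0 i2).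
Qed.

Lemma exists_notin_span (K : fieldType) (u v : 'rV[K]_3) :
  exists w : 'rV[K]_3, forall x y, w <> x *: u + y *: v.
Proof.
have : ~~ (1%:M <= col_mx u v)%MS.
  apply/negP => /mxrankS; rewrite mxrank1 => /leq_trans/(_ (rank_leq_row _)).
  by [].
case/row_subPn => i h; exists (row i 1%:M) => x y e; case/negP: h.
by rewrite e addmx_sub ?scalemx_sub // -addsmxE ?addsmxSl ?addsmxSr.
Qed.

(* The map x + (nfZ a c)^T x + (nfv a c)^T is the flow at time 1 of the vector
   field d/dx0 + a x0 d/dx1 + c x1 d/dx2. *)
Definition nfZ (K : fieldType) (a c : K) : 'M[K]_3 :=
  rows3 (\row_j tnth [tuple 0; a; a * c / 2%:R] j)
        (\row_j tnth [tuple 0; 0; c] j) 0.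

Definition nfv (K : fieldType) (a c : K) : 'rV[K]_3 :=
  \row_j tnth [tuple 1; a / 2%:R; a * c / 6%:R] j.

Lemma mul_nfZ (K : fieldType) (a c : K) (q0 q1 q2 : 'rV[K]_3) (N : 'M_3) :
  q0 *m N = a *: q1 + (a * c / 2%:R) *: q2 -> q1 *m N = c *: q2 ->
  q2 *m N = 0 -> rows3 q0 q1 q2 *m N = nfZ a c *m rows3 q0 q1 q2.
Proof.
move=> e0 e1 e2; apply/row_matrixP; apply: ord3_ind;
  rewrite !row_mul !rowK mul_rows3 !mxE /= ?e0 ?e1 ?e2 ?scale0r ?add0r ?addr0 //.
Qed.

Lemma mul_nfv (K : fieldType) (a c : K) (q0 q1 q2 : 'rV[K]_3) :
  nfv a c *m rows3 q0 q1 q2 = q0 + (a / 2%:R) *: q1 + (a * c / 6%:R) *: q2.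
Proof. by rewrite mul_rows3 !mxE /= scale1r. Qed.

(** Applying N twice, then once, then not at all to a linear relation leaves each time a multiple of
    [q2], which is nonzero. *)
Lemma chain_unit (K : fieldType) (N : 'M[K]_3) (q0 q1 q2 : 'rV[K]_3) t :
  q0 *m N = q1 + t *: q2 -> q1 *m N = q2 -> q2 *m N = 0 -> q2 != 0 ->
  rows3 q0 q1 q2 \in unitmx.
Proof.
move=> e0 e1 e2 q20; apply: rows3_unit => x y z h.
have /eqP := congr1 (fun u => u *m N *m N) h.
rewrite !mulmxDl -!scalemxAl e0 e1 !mulmxDl -!scalemxAl e1.
rewrite !(e2, mul0mx, scaler0, addr0) scaler_eq0 (negPf q20) orbF => /eqP x0.
move: h; rewrite x0 scale0r add0r => h.
have /eqP := congr1 (fun u => u *m N) h.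
rewrite !mulmxDl -!scalemxAl e1 !(e2, mul0mx, scaler0, addr0) scaler_eq0.
rewrite (negPf q20) orbF => /eqP y0; move/eqP: h; rewrite y0 scale0r add0r scaler_eq0.
by rewrite (negPf q20) orbF => /eqP.
Qed.

Lemma nilp_min (K : fieldType) (N : 'M[K]_3) (u : 'rV[K]_3) k :
  N ^+ k = 0 -> u != 0 -> exists2 l, u *m N ^+ l != 0 & u *m N ^+ l.+1 = 0.
Proof.
move=> Nk u0; have ex : exists l, u *m N ^+ l == 0.
  by exists k; rewrite Nk mulmx0.
case: (ex_minnP ex) => [[|l] /eqP e min].
  by case/eqP: u0; rewrite -[u]mulmx1.
by exists l => //; apply/negP => /min; rewrite ltnn.
Qed.

(** Vectors are rows here, so the affine map is read transposed. Four cases: N^2 nonzero, where [b]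
    outside the image makes [b] cyclic (a = c = 1); N^2 = 0 with b N nonzero (a = 1, c = 0); N = 0
    (a = c = 0); and b N = N^2 = 0 with N nonzero (a = 0, c = 1). *)
Lemma nilp_normal_form (K : fieldType) (N : 'M[K]_3) (b : 'rV[K]_3) k :
  [pchar K] =i pred0 -> N ^+ k = 0 -> ~~ (b <= N)%MS ->
  exists Q a c, [/\ Q \in unitmx, Q *m N = nfZ a c *m Q & b = nfv a c *m Q].
Proof.
move=> hK Nk bN.
have bIm x u : x *: b = u *m N -> x = 0.
  move=> e; apply/eqP; apply: contraR bN => x0.
  by rewrite -[b](scalerK x0) e scalemxAl submxMl.
have hn j : j.+1%:R != 0 :> K by apply: natr_neq0.
have [N2|N2] := eqVneq (N *m N) 0; last first.
  have [p pN2] : exists p : 'rV_3, p *m (N *m N) != 0.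
    have [i hi] : exists i, row i (N *m N) != 0.
      apply/existsP; apply: contraR N2 => /existsPn h; apply/eqP/row_matrixP => i.
      by rewrite row0; apply/eqP; move: (h i); rewrite negbK.
    by exists (delta_mx 0 i); rewrite -rowE.
  have [l e eN] := nilp_min Nk pN2.
  pose r := p *m N ^+ l.
  have r2 : r *m N *m N != 0.
    rewrite /r -!mulmxA -[N *m N]/(N * N) -[_ *m (N * N)]/(_ * (N * N)) -expr2.
    by rewrite -exprD addnC exprD expr2 -[_ * _]/(N *m N *m _) mulmxA.
  have r3 : r *m N *m N *m N = 0.
    rewrite /r -!mulmxA -[N *m (N *m N)]/(N ^+ 3) -[N ^+ l *m _]/(N ^+ l * N ^+ 3).
    rewrite -exprD addnC (_ : (3 + l = 2 + l.+1)%N) // exprD expr2.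
    by rewrite -[_ * _]/(N *m N *m N ^+ l.+1) mulmxA.
  have uR : rows3 r (r *m N) (r *m N *m N) \in unitmx.
    by apply: (chain_unit (N := N) (t := 0)); rewrite ?scale0r ?addr0.
  have [x [y [z eb]]] := rows3_span b uR.
  have x0 : x != 0.
    apply: contraNneq bN => x0; rewrite eb x0 scale0r add0r.
    by rewrite addmx_sub ?scalemx_sub ?submxMl.
  have b2 : b *m N *m N = x *: (r *m N *m N).
    by rewrite eb !mulmxDl -!scalemxAl r3 mul0mx !scaler0 !addr0.
  have b3 : b *m N *m N *m N = 0 by rewrite b2 -scalemxAl r3 scaler0.
  (* These solve b = q0 + q1/2 + q2/6, b N = q1 + q2, b N^2 = q2, the equations of the normal form
     for a = c = 1. *)
  pose q2 := b *m N *m N; pose q1 := b *m N - q2.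
  pose q0 := b - 2%:R^-1 *: (b *m N) + 3%:R^-1 *: q2.
  have e2 : q2 *m N = 0 by rewrite b3.
  have e1 : q1 *m N = q2 by rewrite mulmxBl e2 subr0.
  have e0 : q0 *m N = q1 + 2%:R^-1 *: q2.
    rewrite mulmxDl mulmxBl -!scalemxAl e2 scaler0 addr0 /q1 -/q2.
    apply/rowP => j; rewrite !mxE; field.
    by rewrite hn.
  exists (rows3 q0 q1 q2), 1, 1; split.
  - by apply: (chain_unit e0 e1 e2); rewrite /q2 b2 scaler_eq0 negb_or x0.
  - by apply: mul_nfZ; rewrite ?scale1r ?mulr1 ?div1r.
  rewrite mul_nfv mulr1 !div1r; apply/rowP => j; rewrite /q0 /q1 !mxE; field.
  by rewrite !hn.
have N2u (u : 'rV_3) : u *m N *m N = 0 by rewrite -mulmxA N2 mulmx0.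
have b0 : b != 0 by apply: contraNneq bN => ->; apply: sub0mx.
have [bN0|bN0] := eqVneq (b *m N) 0; last first.
  have [w hw] := exists_notin_span b (b *m N).
  have ind x y z : x *: b + y *: (b *m N) + z *: w = 0 ->
      [/\ x = 0, y = 0 & z = 0].
    move=> h; have z0 : z = 0.
      apply/eqP/negPn/negP => z0; apply: (hw (- (z^-1 * x)) (- (z^-1 * y))).
      rewrite -[LHS](scalerK z0) (_ : z *: w = - (x *: b + y *: (b *m N))).
        by rewrite scalerN scalerDr !scalerA opprD !scaleNr.
      by apply/eqP; rewrite -addr_eq0 addrC h.
    move: h; rewrite z0 scale0r addr0 => h.
    have /eqP := congr1 (fun u => u *m N) h.
    rewrite mulmxDl -!scalemxAl N2u mul0mx scaler0 addr0 scaler_eq0 (negPf bN0).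
    rewrite orbF => /eqP x0; move/eqP: h; rewrite x0 scale0r add0r scaler_eq0.
    by rewrite (negPf bN0) orbF => /eqP.
  have [x [y [z ew]]] := rows3_span (w *m N) (rows3_unit ind).
  (* Applying N to w N = x b + y b N + z w and expanding in the basis b, b N, w. The outcome w N = y
     b N shows that w - y b is killed by N. *)
  have [zx zy z2] : [/\ z * x = 0, x + z * y = 0 & z * z = 0].
    apply: ind; have := N2u w; rewrite {1}ew !mulmxDl -!scalemxAl N2u scaler0 addr0.
    rewrite ew => <-; apply/rowP => j; rewrite !mxE; ring.
  have z0 : z = 0 by move/eqP: z2; rewrite mulf_eq0 orbb => /eqP.
  have x0 : x = 0 by move: zy; rewrite z0 mul0r addr0.
  have ew' : w *m N = y *: (b *m N) by rewrite ew z0 x0 !scale0r add0r addr0.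
  exists (rows3 (b - 2%:R^-1 *: (b *m N)) (b *m N) (w - y *: b)), 1, 0; split.
  - apply: rows3_unit => x' y' z' h.
    have [e0 e1 e2] : [/\ x' - z' * y = 0, y' - x' / 2%:R = 0 & z' = 0].
      by apply: ind; rewrite -{}h; apply/rowP => j; rewrite !mxE; ring.
    have x'0 : x' = 0 by move: e0; rewrite e2 mul0r subr0.
    by split=> //; move: e1; rewrite x'0 mul0r subr0.
  - apply: mul_nfZ; rewrite ?mulr0 ?mul0r ?scale0r ?addr0 ?scale1r.
    + by rewrite mulmxBl -scalemxAl N2u scaler0 subr0.
    + exact: N2u.
    by rewrite mulmxBl -scalemxAl ew' subrr.
  by rewrite mul_nfv mulr0 mul0r scale0r addr0 div1r subrK.
have [N0|N0] := eqVneq N 0.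
  have [v hv] := exists_notin_span b 0.
  have [w hw] := exists_notin_span b v.
  exists (rows3 b v w), 0, 0; split.
  - apply: rows3_unit => x y z h; have z0 : z = 0.
      apply/eqP/negPn/negP => z0; apply: (hw (- (z^-1 * x)) (- (z^-1 * y))).
      rewrite -[LHS](scalerK z0) (_ : z *: w = - (x *: b + y *: v)).
        by rewrite scalerN scalerDr !scalerA opprD !scaleNr.
      by apply/eqP; rewrite -addr_eq0 addrC h.
    move: h; rewrite z0 scale0r addr0 => h; have y0 : y = 0.
      apply/eqP/negPn/negP => y0; apply: (hv (- (y^-1 * x)) 0).
      rewrite -[LHS](scalerK y0) (_ : y *: v = - (x *: b)).
        by rewrite scalerN scalerA scaleNr scale0r addr0.
      by apply/eqP; rewrite -addr_eq0 addrC h.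
    move: h => /eqP; rewrite y0 scale0r addr0 scaler_eq0 (negPf b0) orbF.
    by move=> /eqP.
  - by apply: mul_nfZ; rewrite N0 !mulmx0 ?mul0r ?scale0r ?addr0.
  by rewrite mul_nfv !mul0r !scale0r !addr0.
have [p pN] : exists p : 'rV_3, p *m N != 0.
  have [i hi] : exists i, row i N != 0.
    apply/existsP; apply: contraR N0 => /existsPn h; apply/eqP/row_matrixP => i.
    by rewrite row0; apply/eqP; move: (h i); rewrite negbK.
  by exists (delta_mx 0 i); rewrite -rowE.
exists (rows3 b p (p *m N)), 0, 1; split.
- apply: rows3_unit => x y z h.
  have /eqP := congr1 (fun u => u *m N) h.
  rewrite !mulmxDl -!scalemxAl N2u bN0 mul0mx !scaler0 add0r addr0.
  rewrite scaler_eq0 (negPf pN) orbF => /eqP y0; move: h.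
  rewrite y0 scale0r addr0 => h; have x0 : x = 0.
    apply: (bIm x (- z *: p)); rewrite -scalemxAl scaleNr.
    by apply/eqP; rewrite -addr_eq0 h.
  move/eqP: h; rewrite x0 scale0r add0r scaler_eq0 (negPf pN) orbF.
  by move=> /eqP.
- apply: mul_nfZ; rewrite ?mul0r ?scale0r ?addr0 ?scale1r //; exact: N2u.
by rewrite mul_nfv !mul0r !scale0r !addr0.
Qed.

(** * Values and Jacobian matrices at the origin *)

Lemma mcoeff0_comp0 (n : nat) (K : fieldType) (t : n.-tuple {mpoly K[n]}) p :
  (forall i, (tnth t i)@_0 = 0) -> (p \mPo t)@_0 = p@_0.
Proof.
move=> t0; rewrite -[in RHS](comp_mpoly_id p) !mcoeff0_comp; apply: meval_eq => i.
by rewrite t0 tnth_mktuple mcoeffX mnm1_eq0.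
Qed.

Lemma mcoeffU_M (n : nat) (K : fieldType) (p q : {mpoly K[n]}) j :
  (p * q)@_U_(j) = p@_U_(j) * q@_0 + p@_0 * q@_U_(j).
Proof.
have e (r : {mpoly K[n]}) : r@_U_(j) = (mderiv j r)@_0.
  by rewrite mcoeff_deriv add0m mnm0E mulr1n.
by rewrite !e mderivM mcoeffD !(rmorphM (mcoeff 0%MM)).
Qed.

(** The chain rule at the origin. Each nonconstant monomial has the form x_i q, so the product rule
    is enough and no induction on degrees is made. *)
Lemma mcoeffU_comp (n : nat) (K : fieldType) (t : n.-tuple {mpoly K[n]}) p j :
  (forall i, (tnth t i)@_0 = 0) ->
  (p \mPo t)@_U_(j) = \sum_i p@_U_(i) * (tnth t i)@_U_(j).
Proof.
move=> t0; pose E p := (p \mPo t)@_U_(j) = \sum_i p@_U_(i) * (tnth t i)@_U_(j).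
have EX i q : E ('X_i * q).
  rewrite /E rmorphM /= pullX mcoeffU_M t0 mul0r addr0 mcoeff0_comp0 //.
  rewrite (bigD1 i) //= big1 => [|k ki]; last first.
    rewrite mcoeffU_M mcoeffXU eq_sym (negPf ki) mcoeffX mnm1_eq0.
    by rewrite mul0r mul0r addr0 mul0r.
  by rewrite mcoeffU_M mcoeffXU mcoeffX mnm1_eq0 eqxx mul1r mul0r !addr0 mulrC.
elim/mpolyind: p => [|c m p _ _ IH].
  by rewrite comp_mpoly0 mcoeff0 big1 // => i _; rewrite mcoeff0 mul0r.
rewrite comp_mpolyD mcoeffD IH comp_mpolyZ mcoeffZ.
have -> : ('X_[m] \mPo t)@_U_(j) = \sum_i 'X_[m]@_U_(i) * (tnth t i)@_U_(j).
  case: (eqVneq m 0%MM) => [->|m0].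
    rewrite mpolyX0 comp_mpoly1 mcoeff1 mnm1_eq0 big1 // => i _.
    by rewrite mcoeff1 mnm1_eq0 mul0r.
  have [i mi] : exists i, m i != 0%N.
    apply/existsP; apply: contraR m0 => /existsPn h; apply/eqP/mnmP => i.
    by rewrite mnm0E; move: (h i); rewrite negbK => /eqP.
  have -> : m = (U_(i) + (m - U_(i)))%MM.
    by rewrite addmC submK // lep1mP.
  by rewrite mpolyXD; apply: EX.
rewrite mulr_sumr -big_split /=; apply: eq_bigr => i _.
by rewrite mcoeffD mcoeffZ; ring.
Qed.

(** The value of [phi * psi] at the origin is [phi] evaluated at the point [val0 psi]. *)
Lemma val0_mul (n : nat) (K : fieldType) (phi psi xi : GA n K) :
  val0 psi = val0 xi -> val0 (phi * psi)%g = val0 (phi * xi)%g.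
Proof.
move=> e; apply/matrixP => i j; rewrite !mxE !comp_GAM !mcoeff0_comp.
by apply: meval_eq => k; move/matrixP/(_ k 0): e; rewrite !mxE.
Qed.

Lemma val0_1 (n : nat) (K : fieldType) : val0 (1%g : GA n K) = 0.
Proof.
by apply/matrixP => i j; rewrite !mxE comp_GA1 mcoeffX mnm1_eq0.
Qed.

Lemma val0_aff (n : nat) (K : fieldType) (M : 'M[K]_n) b psi :
  M \in unitmx -> val0 (aff M b * psi)%g = M *m val0 psi + b.
Proof.
move=> uM; apply/matrixP => i j; rewrite !mxE comp_GAM comp_aff // /aff_comp.
rewrite comp_mpolyD comp_mpolyC mcoeffD mcoeffC eqxx mulr1.
rewrite (raddf_sum (comp_mpoly _)) raddf_sum /=.
rewrite ord1; congr (_ + _); apply: eq_bigr => k _.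
by rewrite comp_mpolyZ pullX mcoeffZ !mxE.
Qed.

Lemma val0_mul0 (n : nat) (K : fieldType) (phi psi : GA n K) :
  val0 phi = 0 -> val0 psi = 0 -> val0 (phi * psi)%g = 0.
Proof.
move=> e0 e1; rewrite -e0 -[in RHS](mulg1 phi); apply: val0_mul.
by rewrite e1 val0_1.
Qed.

Lemma val0_inv (n : nat) (K : fieldType) (phi : GA n K) :
  val0 phi = 0 -> val0 (phi^-1)%g = 0.
Proof.
move=> e; rewrite -[in LHS](mulg1 phi^-1%g) -(@val0_1 n K) -[in RHS](mulVg phi).
by apply: val0_mul; rewrite e val0_1.
Qed.

Lemma jac0_mul (n : nat) (K : fieldType) (phi psi : GA n K) :
  val0 psi = 0 -> jac0 (phi * psi)%g = jac0 phi *m jac0 psi.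
Proof.
move=> e; apply/matrixP => i j; rewrite !mxE comp_GAM mcoeffU_comp.
  by apply: eq_bigr => k _; rewrite !mxE.
by move=> k; move/matrixP/(_ k 0): e; rewrite !mxE.
Qed.

Lemma jac0_aff (n : nat) (K : fieldType) (M : 'M[K]_n) b :
  M \in unitmx -> jac0 (aff M b) = M.
Proof.
by move=> uM; apply/matrixP => i j; rewrite mxE comp_aff // aff_comp_coefU.
Qed.

Lemma jac0_unit (n : nat) (K : fieldType) (phi : GA n K) :
  val0 phi = 0 -> jac0 phi \in unitmx.
Proof.
move=> e; suff /mulmx1_unit[] : jac0 phi *m jac0 phi^-1%g = 1%:M by [].
rewrite -jac0_mul; last exact: val0_inv.
by rewrite mulgV -aff1 jac0_aff ?unitmx1.
Qed.

Lemma dil_aff (n : nat) (K : fieldType) (d : 'I_n -> K) :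
  (forall i, d i != 0) ->
  diag_mx (\row_i d i) \in unitmx /\ dil d = aff (diag_mx (\row_i d i)) 0.
Proof.
move=> d0; have u : diag_mx (\row_i d i) \in unitmx.
  rewrite unitmxE det_diag unitfE; apply/prodf_neq0 => i _.
  by rewrite mxE d0.
split=> //; apply: GA_ext => i; rewrite comp_dil // comp_aff // /aff_comp mxE.
rewrite mpolyC0 addr0 (bigD1 i) //= big1 => [|j ji]; last first.
  by rewrite !mxE eq_sym (negPf ji) scale0r.
by rewrite !mxE eqxx mulr1n addr0.
Qed.

(** * Automorphisms conjugating a translation to an affine map *)

Definition lin (n : nat) (K : fieldType) (c : 'rV[K]_n) : {mpoly K[n]} :=
  \sum_j c 0 j *: 'X_j.

Lemma linB (n : nat) (K : fieldType) (c c' : 'rV[K]_n) :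
  lin (c - c') = lin c - lin c'.
Proof.
rewrite /lin -sumrB; apply: eq_bigr => j _.
by rewrite !mxE scalerBl.
Qed.

Lemma lin_aff (n : nat) (K : fieldType) (c : 'rV[K]_n) M b : M \in unitmx ->
  lin c \mPo GA_tuple (aff M b) = lin (c *m M) + ((c *m b) 0 0)%:MP.
Proof.
move=> uM; rewrite affE // /lin raddf_sum /= !mxE raddf_sum /=.
under eq_bigr => j _ do rewrite comp_mpolyZ pullX tnth_mktuple scalerDr
  scaler_sumr.
rewrite big_split /= exchange_big /=; congr (_ + _); apply: eq_bigr => j _.
  rewrite mxE scaler_suml.
  by apply: eq_bigr => k _; rewrite scalerA.
by rewrite -mul_mpolyC -mpolyCM.
Qed.

Lemma lin_coef (n : nat) (K : fieldType) (c : 'rV[K]_n) d j :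
  (lin c + d%:MP)@_U_(j) = c 0 j.
Proof.
rewrite mcoeffD mcoeffC mnm1_eq0 mulr0 addr0 raddf_sum /= (bigD1 j) //=.
rewrite mcoeffZ mcoeffXU eqxx mulr1 big1 ?addr0 // => k kj.
by rewrite mcoeffZ mcoeffXU (negPf kj) mulr0.
Qed.

(* The coordinates of phi span a space stable under the translation. *)
Lemma conj_translation_nilp (K : fieldType) (phi : GA 3 K) w M b :
  M \in unitmx -> (phi * tran w = aff M b * phi)%g ->
  exists k, (M - 1) ^+ k = 0.
Proof.
move=> uM e; have D (c : 'rV_3) k : exists d,
    iter k (diff w) (lin c \mPo GA_tuple phi)
    = (lin (c *m (M - 1) ^+ k) + d%:MP) \mPo GA_tuple phi.
  elim: k => [|k [d IH]]; first by exists 0; rewrite mulmx1 mpolyC0 addr0.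
  exists (((c *m (M - 1) ^+ k) *m b) 0 0).
  rewrite iterS IH comp_mpolyD diffD comp_mpolyC diffC addr0 /diff -pullM e.
  rewrite pullM lin_aff // exprSr -[_ * (M - 1)]/(_ *m (M - 1)) mulmxA.
  by rewrite mulmxBr mulmx1 linB !comp_mpolyD comp_mpolyN comp_mpolyC addrAC.
(* Differences are nilpotent on each polynomial and substitution of [phi] is injective, so a power
   of [M - 1] kills each row [c]; the constant [d] is discarded by reading linear coefficients. *)
have R (c : 'rV_3) : exists k, c *m (M - 1) ^+ k = 0.
  have [k hk] := diff_nilpotent w (lin c \mPo GA_tuple phi); exists k.
  have [d] := D c k; rewrite hk => /esym/eqP.
  rewrite -(comp_mpoly0 (GA_tuple phi)) => /eqP/pull_inj h.
  by apply/rowP => j; rewrite -(lin_coef _ d) h mcoeff0 mxE.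
have [k0 h0] := R (delta_mx 0 i0); have [k1 h1] := R (delta_mx 0 i1).
have [k2 h2] := R (delta_mx 0 i2); exists (k0 + k1 + k2)%N.
have z (c : 'rV_3) k l : c *m (M - 1) ^+ k = 0 -> (k <= l)%N ->
    c *m (M - 1) ^+ l = 0.
  move=> h kl; rewrite -(subnKC kl) exprD -[_ * _]/(_ *m _) mulmxA h.
  by rewrite mul0mx.
apply/row_matrixP; apply: ord3_ind; rewrite row0 rowE.
- by apply: z h0 _; rewrite -addnA leq_addr.
- by apply: z h1 _; rewrite addnAC leq_addl.
by apply: z h2 _; rewrite leq_addl.
Qed.

(** [phi^-1] sends a fixed point of the affine map to a fixed point of the translation, and only the
    zero translation has one. *)
Lemma conj_translation_nofix (n : nat) (K : fieldType) (phi : GA n K) w M b q :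
  M \in unitmx -> (phi * tran w = aff M b * phi)%g -> M *m q + b = q -> w = 0.
Proof.
move=> uM e fixq; pose r := val0 (phi^-1 * tran q)%g.
have e' : (tran w * phi^-1 = phi^-1 * aff M b)%g.
  by rewrite -[LHS](mulKg phi) (mulgA phi) e mulgK.
have /eqP : val0 (tran w * phi^-1 * tran q)%g = r.
  rewrite e' -mulgA; apply: val0_mul; rewrite val0_aff //.
  have -> : val0 (tran q) = q; last exact: fixq.
  by apply/matrixP => i j; rewrite mxE comp_tran mcoeffD mcoeffX mnm1_eq0
    mcoeffC eqxx mulr1 add0r ord1.
rewrite -mulgA val0_aff ?unitmx1 // mul1mx addrC.
by rewrite -[X in _ == X]add0r (inj_eq (addIr _)) => /eqP.
Qed.

Lemma elem_tran (n : nat) (K : fieldType) (i : 'I_n) :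
  elem i 1 = tran (\col_j (j == i)%:R) :> GA n K.
Proof.
apply: GA_ext => j; rewrite comp_elem ?comp_tran ?mxE; last exact: over1.
by case: eqP => _; rewrite ?mpolyC1 ?mpolyC0.
Qed.

Lemma trmx_exp (K : fieldType) (M : 'M[K]_3) k : (M ^+ k)^T = M^T ^+ k.
Proof.
by elim: k => [|k IH]; rewrite ?trmx1 // exprS exprSr trmx_mul IH.
Qed.

Lemma tnth3 (T : Type) (x y z : T) :
  (tnth [tuple x; y; z] i0 = x) * (tnth [tuple x; y; z] i1 = y)
  * (tnth [tuple x; y; z] i2 = z).
Proof. by []. Qed.

Definition wt (K : fieldType) (i : 'I_3) : K := 2%:R ^+ i.+1.

Lemma wt_neq0 (K : fieldType) : [pchar K] =i pred0 -> forall i, wt K i != 0.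
Proof. by move=> hK i; rewrite expf_neq0 // (natr_neq0 hK). Qed.

(* With x_i of weight i + 1 the vector field generating the affine map below
   is homogeneous, so the dilation by 2 conjugates the map to its square. *)
Lemma dil_normal_form (K : fieldType) (a c : K) : [pchar K] =i pred0 ->
  let M := 1%:M + (nfZ a c)^T in let b := (nfv a c)^T in
  M \in unitmx ->
  (dil (wt K) * aff M b = aff M b * aff M b * dil (wt K))%g.
Proof.
move=> hK M b uM; have [uD ->] := dil_aff (wt_neq0 hK).
have hn j : j.+1%:R != 0 :> K by apply: natr_neq0.
rewrite !affM ?unitmx_mul ?uM // addr0 mulmx0 add0r; congr aff.
  apply/matrixP; elim/ord3_ind; elim/ord3_ind;
    rewrite !mxE !sum3 !mxE !sum3 !mxE /= /wt !tnth3 /=; field; rewrite ?hn //.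
apply/matrixP; elim/ord3_ind => j;
  rewrite ord1 !mxE !sum3 !mxE /= /wt !tnth3 /=; field; rewrite ?hn //.
Qed.

(** Commuting with the dilation makes component i homogeneous of weight i + 1 for the weights 1, 2,
    3 of the variables. So x2 is absent from the first two components and appears in the third only
    as the monomial x2, with coefficient 1 by the hypothesis on the Jacobian matrix. *)
Lemma weighted_translation (K : fieldType) (phi : GA 3 K) :
  [pchar K] =i pred0 -> jac0 phi = 1%:M ->
  (phi * dil (wt K) = dil (wt K) * phi)%g ->
  forall i, component phi i \mPo GA_tuple (elem i2 1)
    = component phi i + (if i == i2 then 1%:MP else 0).
Proof.
move=> hK J e.
have w i m : m \in msupp (component phi i) ->
    (m i0 + m i1 * 2 + m i2 * 3 = i.+1)%N.
  rewrite mcoeff_msupp => mi.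
  have := congr1 (fun psi => (component psi i)@_m) e.
  rewrite /= !comp_GAM comp_dil ?dilE; try exact: wt_neq0.
  rewrite mcoeff_diag comp_mpolyZ pullX -/(component _ _) mcoeffZ.
  move/(mulIf mi); rewrite prod3 /wt -!exprM -!exprD => /(exp2r_inj hK) /=.
  lia.
have o i : i != i2 -> over (other i2) (component phi i).
  move=> ii; apply/overP => m mi j; rewrite negbK => /eqP->.
  by have := w _ _ mi; elim/ord3_ind: i ii mi => //= _ _; lia.
have o2 : over (other i2) (component phi i2 - 'X_i2).
  apply/overP => m; rewrite mcoeff_msupp => mi j; rewrite negbK => /eqP->.
  apply/eqP; apply: contraR mi => m2; rewrite mcoeffB.
  have [mp|mp] := boolP (m \in msupp (component phi i2)).
    have /= wm := w _ _ mp.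
    have -> : m = U_(i2)%MM.
      by apply/mnmP; elim/ord3_ind; rewrite mnm1E /=; lia.
    have /matrixP/(_ i2 i2) := J; rewrite !mxE => ->.
    by rewrite mcoeffXU eqxx subrr.
  rewrite (memN_msupp_eq0 mp) mcoeffX.
  case: (eqVneq U_(i2)%MM m) => [em|_]; last by rewrite subrr.
  move: mp; rewrite -em mcoeff_msupp.
  have /matrixP/(_ i2 i2) := J; rewrite !mxE => ->.
  by rewrite eqxx oner_neq0.
have o1 : over (other i2) (1 : {mpoly K[3]}) by apply: over1.
move=> i; case: (eqVneq i i2) => [->|ii]; last first.
  by rewrite pull_elem ?addr0 //; apply: o.
rewrite -[component phi i2](subrK 'X_i2) comp_mpolyD (pull_elem o2 o1) pullX.
by rewrite -/(component _ _) comp_elem // eqxx addrA mpolyC1.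
Qed.

Lemma comp_shift2 (n : nat) (K : fieldType) (psi : GA n K) (k i : 'I_n) :
  component (elem k 1 * elem k 1 * psi)%g i
  = component psi i + (if i == k then 2%:R%:MP else 0).
Proof.
have o1 : over (other k) (1 : {mpoly K[n]}) by apply: over1.
rewrite -elemD // comp_GAM comp_elem; last exact: overD.
rewrite comp_mpolyD pullX; congr (_ + _); case: ifP => _.
  by rewrite comp_mpolyD !comp_mpoly1 mpolyCD mpolyC1.
by rewrite comp_mpoly0.
Qed.

Lemma val0_affE (n : nat) (K : fieldType) (M : 'M[K]_n) b :
  M \in unitmx -> val0 (aff M b) = b.
Proof. by move=> uM; rewrite -[aff M b]mulg1 val0_aff // val0_1 mulmx0 add0r. Qed.

Lemma val0_dil (n : nat) (K : fieldType) (d : 'I_n -> K) :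
  (forall i, d i != 0) -> val0 (dil d) = 0.
Proof. by move=> d0; have [uD ->] := dil_aff d0; rewrite val0_affE. Qed.

(** The affine map phi^-1 d phi fixes the origin, so it is linear and equals its Jacobian matrix,
    which by the chain rule is the conjugate of d by [jac0 phi]. Hence [invmx (jac0 phi)] serves as
    J. *)
Lemma linearize (n : nat) (K : fieldType) (phi : GA n K) (d : 'I_n -> K) :
  (forall i, d i != 0) -> val0 phi = 0 -> affine (phi^-1 * dil d * phi)%g ->
  exists J, [/\ J \in unitmx, jac0 (phi * aff J 0)%g = 1%:M
    & (phi * aff J 0 * dil d = dil d * (phi * aff J 0))%g].
Proof.
move=> d0 v; set psi := (_ * _ * _)%g => /affineP[uM' epsi].
have uJ := jac0_unit v; have uJi : invmx (jac0 phi) \in unitmx.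
  by rewrite unitmx_inv.
have vL := val0_dil d0; have vi := val0_inv v.
have vpsi : val0 psi = 0 by rewrite !val0_mul0.
exists (invmx (jac0 phi)); split=> //.
  by rewrite jac0_mul ?val0_affE // jac0_aff // mulmxV.
have JM : jac0 phi *m jac0 psi = jac0 (dil d) *m jac0 phi.
  rewrite -(jac0_mul phi vpsi) -(jac0_mul _ v).
  by rewrite /psi !mulgA mulgV mul1g.
have -> : (dil d * (phi * aff (invmx (jac0 phi)) 0)
    = phi * (psi * aff (invmx (jac0 phi)) 0))%g.
  by rewrite /psi !mulgA mulgV mul1g.
rewrite -mulgA; apply: (congr1 (fun x => phi * x)%g).
have [uD eD] := dil_aff d0; move: JM; rewrite eD jac0_aff // => JM.
rewrite epsi vpsi; rewrite !affM // !mulmx0 !addr0; congr aff.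
by rewrite -[LHS](mulmxK uJ) -(mulmxA _ _ (jac0 phi)) -JM mulmxA mulVmx // mul1mx.
Qed.

Lemma affine_translate_normal (K : fieldType) (G : GA 3 K -> Prop) phi a c :
  [pchar K] =i pred0 -> over_affine G -> G phi -> val0 phi = 0 ->
  1%:M + (nfZ a c)^T \in unitmx ->
  (phi * elem i2 1 = aff (1%:M + (nfZ a c)^T) (nfv a c)^T * phi)%g ->
  affine phi \/ forall xi, tame xi -> G xi.
Proof.
move=> hK hG Gphi v uM e; have [GAf GM GV] := hG.
have hn j : j.+1%:R != 0 :> K by apply: natr_neq0.
have aL : affine (dil (wt K)) by apply/affine_dil/wt_neq0.
have eL := dil_normal_form hK uM.
move: (aff _ _) e eL => A e eL.
pose psi := (phi^-1 * dil (wt K) * phi)%g.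
have Gpsi : G psi by apply/GM/Gphi/GM/GAf/aL/GV.
have e3 : (psi * elem i2 1 = elem i2 1 * elem i2 1 * psi)%g.
  have h : (phi^-1 * A = elem i2 1 * phi^-1)%g.
    by rewrite -[RHS](mulKg phi) (mulgA phi) e mulgK.
  rewrite /psi -!mulgA e (mulgA (dil _)) eL !mulgA h -!mulgA.
  by rewrite (mulgA phi^-1%g A) h !mulgA.
have tC i : component psi i \mPo GA_tuple (elem i2 1)
    = component psi i + (if i == i2 then 2%:R%:MP else 0).
  by rewrite -comp_GAM e3; exact: comp_shift2.
have [apsi|] := translation_degenerate hK hG Gpsi (hn 1%N) tC; last by right.
have [J [uJ J3 e4]] := linearize (wt_neq0 hK) v apsi.
have aJ : affine (aff J 0) by apply: affine_aff.
have G3 : G (phi * aff J 0)%g by apply/GM/GAf/aJ/Gphi.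
(* Second use of [translation_degenerate]: the corrected [phi] commutes with the translation itself,
   so c = 1 here, against c = 2 for [psi]. *)
have [a3|] := translation_degenerate hK hG G3 (oner_neq0 K)
  (weighted_translation hK J3 e4); last by right.
left; rewrite -(mulgK (aff J 0) phi); apply: affine_mul a3 _.
exact: affine_inv.
Qed.

(** Reduction to [affine_translate_normal]: a solution of b = (M - 1) u would give the fixed point
    -u, so the transposed map satisfies the hypotheses of [nilp_normal_form]. An affine change of
    coordinates on the left then normalises the map. *)
Lemma affine_translate (K : fieldType) (G : GA 3 K -> Prop) phi :
  [pchar K] =i pred0 -> over_affine G -> G phi ->
  affine (phi * elem i2 1 * phi^-1)%g ->
  affine phi \/ forall xi, tame xi -> G xi.
Proof.
move=> hK hG Gphi; set A := (_ * _ * _)%g => /affineP[].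
have [GAf GM GV] := hG.
move: (jac0 A) (val0 A) => M b uM eA.
pose w : 'cV[K]_3 := \col_j (j == i2)%:R.
have et : elem i2 1 = tran w by apply: elem_tran.
have e : (phi * tran w = aff M b * phi)%g by rewrite -eA /A et mulgVK.
have [k Nk] := conj_translation_nilp uM e.
have bN : ~~ (b^T <= (M - 1)^T)%MS.
  apply/negP => /submxP[u eu].
  have eb : b = (M - 1) *m u^T by rewrite -[b]trmxK eu trmx_mul trmxK.
  have : w = 0.
    apply: (conj_translation_nofix (q := - u^T) uM e).
    by rewrite eb mulmxN mulmxBl mul1mx addrA addNr add0r.
  move/matrixP/(_ i2 0); rewrite !mxE eqxx => /eqP.
  by rewrite (negPf (natr_neq0 hK 0%N)).
have Nk' : (M - 1)^T ^+ k = 0 by rewrite -trmx_exp Nk trmx0.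
have [Q [a [c [uQ eQ ebQ]]]] := nilp_normal_form hK Nk' bN.
pose P := invmx Q^T; have uQT : Q^T \in unitmx by rewrite unitmx_tr.
have uP : P \in unitmx by rewrite unitmx_inv.
pose M1 := 1%:M + (nfZ a c)^T; pose b1 := (nfv a c)^T.
have PM : P *m M = M1 *m P.
  have -> : M = 1 + (M - 1) by rewrite addrC subrK.
  have -> : M - 1 = Q^T *m (nfZ a c)^T *m P.
    by rewrite -trmx_mul -eQ trmx_mul trmxK /P mulmxK.
  rewrite mulmxDr mulmx1 /M1 mulmxDl mul1mx; congr (_ + _).
  by rewrite !mulmxA mulVmx // mul1mx.
have Pb : P *m b = b1.
  by rewrite -[b]trmxK ebQ trmx_mul mulmxA mulVmx // mul1mx.
have uM1 : M1 \in unitmx.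
  have -> : M1 = P *m M *m invmx P by rewrite PM mulmxK.
  by rewrite !unitmx_mul uP uM unitmx_inv.
have aP : affine (aff P 0) by apply: affine_aff.
have e1 : (aff P 0 * phi * tran w = aff M1 b1 * (aff P 0 * phi))%g.
  rewrite -mulgA e !mulgA !affM // PM Pb mulmx0.
  by rewrite addr0 add0r.
have G1 : G (aff P 0 * phi)%g by apply/GM/Gphi/GAf/aP.
clearbody P; clear PM Pb.
have aff1 : affine (aff P 0 * phi)%g -> affine phi.
  by move=> h; rewrite -(mulKg (aff P 0) phi); apply/affine_mul/h/affine_inv.
move: (aff P 0 * phi)%g e1 G1 aff1 => phi1 e1 G1 aff1.
(* Precomposing with the translation to the point phi1^-1(0) makes the origin map to itself; the
   conjugacy relation survives since translations commute. *)
have ap := affine_tran (val0 phi1^-1%g).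
have v2 : val0 (phi1 * tran (val0 phi1^-1))%g = 0.
  rewrite -(@val0_1 3 K) -(mulgV phi1); apply: val0_mul.
  by rewrite val0_affE ?unitmx1.
have e2 : (phi1 * tran (val0 phi1^-1) * tran w
    = aff M1 b1 * (phi1 * tran (val0 phi1^-1)))%g.
  rewrite mulgA -e1 -!mulgA; apply: (congr1 (fun x => phi1 * x)%g).
  by rewrite /tran !affM ?unitmx1 // !mul1mx addrC.
move: (tran (val0 phi1^-1)%g) ap v2 e2 => s ap v2 e2.
have G2 : G (phi1 * s)%g by apply/GM/GAf/ap/G1.
rewrite -et in e2.
have [h|] := affine_translate_normal hK hG G2 v2 uM1 e2; last by right.
left; apply: aff1; rewrite -(mulgK s phi1); apply: affine_mul h _.
exact: affine_inv.
Qed.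

(** * Triangular automorphisms *)

Lemma pullXc (n : nat) (K : fieldType) (phi : GA n K) i :
  'X_i \mPo GA_tuple phi = component phi i.
Proof. exact: pullX. Qed.

Lemma low_mono (n : nat) (K : fieldType) k l (p : {mpoly K[n]}) :
  (k <= l)%N -> low k p -> low l p.
Proof. by move=> kl; apply: sub_over => j /leq_trans; apply. Qed.

Lemma lowX (n : nat) (K : fieldType) k (i : 'I_n) :
  (i < k)%N -> low k ('X_i : {mpoly K[n]}).
Proof. exact: overX. Qed.

Lemma tri_inv (n : nat) (K : fieldType) (tau : GA n K) u P :
  (forall i : 'I_n, [/\ u i != 0, low i (P i)
    & component tau i = u i *: 'X_i + P i]) ->
  forall i : 'I_n, low i.+1 (component tau^-1%g i) /\
    component tau^-1%g i = (u i)^-1 *: ('X_i - (P i \mPo GA_tuple tau^-1%g)).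
Proof.
move=> h; have e i : component tau^-1%g i
    = (u i)^-1 *: ('X_i - (P i \mPo GA_tuple tau^-1%g)).
  have [u0 _ ei] := h i; have := comp_GA1 K i; rewrite -(mulgV tau) comp_GAM ei.
  rewrite comp_mpolyD comp_mpolyZ pullX -/(component _ _) => <-.
  by rewrite addrK scalerA mulVf // scale1r.
have l k (i : 'I_n) : (i < k)%N -> low i.+1 (component tau^-1%g i).
  elim: k i => // k IH i ik; rewrite e; apply: overZ.
  apply: overD; first exact: overX.
  have [_ lP _] := h i; apply/overN/(over_comp lP) => j ji.
  by apply: low_mono (IH j _); rewrite ?ltnS ?(ltnW ji) // (leq_trans ji).
by move=> i; split; [apply: (l n) | apply: e].
Qed.

Definition unitri (n : nat) (K : fieldType) (s : GA n K) :=
  forall i : 'I_n, low i (component s i - 'X_i).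

Lemma unitriE (n : nat) (K : fieldType) (s : GA n K) : unitri s ->
  forall i : 'I_n, [/\ (1 : K) != 0, low i (component s i - 'X_i)
    & component s i = 1 *: 'X_i + (component s i - 'X_i)].
Proof.
by move=> h i; split; rewrite ?oner_neq0 // scale1r [RHS]addrC subrK.
Qed.

Lemma unitri_low (n : nat) (K : fieldType) (s : GA n K) k (i : 'I_n) :
  unitri s -> (i < k)%N -> low k (component s i).
Proof.
move=> h ik; rewrite -[component s i](subrK 'X_i); apply: overD; last exact: overX.
by apply: low_mono (h i); apply: ltnW.
Qed.

Lemma unitri_comp (n : nat) (K : fieldType) (s : GA n K) k p :
  unitri s -> low k p -> low k (p \mPo GA_tuple s).
Proof. by move=> h hp; apply: over_comp hp _ => j jk; apply: unitri_low. Qed.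

Lemma unitri_mul (n : nat) (K : fieldType) (s t : GA n K) :
  unitri s -> unitri t -> unitri (s * t)%g.
Proof.
move=> hs ht i; rewrite comp_GAM -[component s i](subrK 'X_i) comp_mpolyD pullX.
rewrite -/(component _ _) -addrA; apply: overD; last exact: ht.
exact: unitri_comp.
Qed.

Lemma unitri_inv (n : nat) (K : fieldType) (s : GA n K) :
  unitri s -> unitri (s^-1)%g.
Proof.
move=> hs i; have h := tri_inv (unitriE hs); have [_ ->] := h i.
rewrite invr1 scale1r addrAC subrr add0r; apply/overN/(over_comp (hs i)) => j ji.
exact: low_mono (h j).1.
Qed.

Lemma unitri_tran (n : nat) (K : fieldType) (w : 'cV[K]_n) : unitri (tran w).
Proof. by move=> i; rewrite comp_tran addrC addKr; apply: overC. Qed.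

(** The scalars of [tau] cancel against those of [tau^-1], and the translation adds only constants
    to the variables. *)
Lemma tri_conj_tran (n : nat) (K : fieldType) (tau : GA n K) v :
  triangular tau -> unitri (tau * tran v * tau^-1)%g.
Proof.
case=> u [P h]; have h' (i : 'I_n) : [/\ u i != 0, low i (P i)
    & component tau i = u i *: 'X_i + P i].
  by have [? ? ?] := h i; split=> //; apply/lowP.
have hi := tri_inv h'; move=> i; have [u0 lP ei] := h' i.
have lc p : low i p -> low i (p \mPo GA_tuple tau^-1%g).
  by move=> hp; apply: over_comp hp _ => j ji; apply: low_mono (hi j).1.
rewrite !comp_GAM ei !(comp_mpolyD, comp_mpolyZ) pullX -/(component _ _).
rewrite comp_tran comp_mpolyD comp_mpolyC pullX -/(component _ _) (hi i).2.
have E (x a b q : {mpoly K[n]}) : x - a + b + q - x = b - a + q by ring.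
rewrite scalerDr scalerA divff // scale1r E; apply/overD/lc; last first.
  exact: unitri_comp (unitri_tran v) lP.
by apply: overD; [apply/overZ/overC | apply/overN/lc].
Qed.

Definition commu (gT : groupType) (t s : gT) := (s * t * s^-1 * t^-1)%g.

Lemma unitri_commu (n : nat) (K : fieldType) (w : 'cV[K]_n) s :
  unitri s -> unitri (commu (tran w) s).
Proof.
move=> hs; have ht := unitri_tran w; rewrite /commu.
by do !apply: unitri_mul => //; apply: unitri_inv.
Qed.

Lemma tranV (n : nat) (K : fieldType) (w : 'cV[K]_n) :
  ((tran w)^-1)%g = tran (- w).
Proof. by rewrite /tran affV ?unitmx1 // invmx1 mulNmx mul1mx. Qed.

(** On the first component that [s] moves, say x_k -> x_k + R with R in lower variables, which [s]
    fixes, a commutator with the translation replaces R by a difference of R. *)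
Lemma comp_commu (n : nat) (K : fieldType) (w : 'cV[K]_n) s (k : 'I_n) :
  unitri s -> (forall j : 'I_n, (j < k)%N -> component s j = 'X_j) ->
  (forall j : 'I_n, (j < k)%N -> component (commu (tran w) s) j = 'X_j) /\
  component (commu (tran w) s) k - 'X_k
    = - diff (- w) (component s k - 'X_k).
Proof.
move=> hs sj.
have si (j : 'I_n) : (j < k)%N -> component (s^-1)%g j = 'X_j.
  move=> jk; have := comp_GA1 K j; rewrite -(mulgV s) comp_GAM sj //.
  by rewrite pullX -/(component _ _).
have fix_ p : low k p -> p \mPo GA_tuple (s^-1)%g = p.
  by move=> hp; apply: (over_comp_id hp) => j; apply: si.
split=> [j jk|].
  rewrite /commu !comp_GAM sj // pullXc comp_tran !comp_mpolyD !comp_mpolyC.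
  rewrite pullXc si // tranV pullXc comp_tran mxE.
  by rewrite mpolyCN -addrA addNr addr0.
have lR := hs k; set R := component s k - 'X_k in lR *.
have sk : component s k = 'X_k + R by rewrite /R addrC subrK.
clearbody R.
have sVk : component (s^-1)%g k = 'X_k - R.
  have := comp_GA1 K k; rewrite -(mulgV s) comp_GAM sk comp_mpolyD pullXc fix_ //.
  by move=> <-; rewrite addrK.
have lRt : low k (R \mPo GA_tuple (tran w)) := unitri_comp (unitri_tran w) lR.
rewrite /commu !comp_GAM sk comp_mpolyD pullXc comp_tran !comp_mpolyD.
rewrite !comp_mpolyC pullXc sVk (fix_ _ lRt) comp_mpolyB pullXc -pullM mulgV.
rewrite pull1 tranV comp_tran /diff mxE mpolyCN; ring.
Qed.

Lemma iter_commu (n : nat) (K : fieldType) (w : 'cV[K]_n) s (k : 'I_n) l :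
  unitri s -> (forall j : 'I_n, (j < k)%N -> component s j = 'X_j) ->
  [/\ unitri (iter l (commu (tran w)) s),
      forall j : 'I_n, (j < k)%N -> component (iter l (commu (tran w)) s) j = 'X_j
    & component (iter l (commu (tran w)) s) k - 'X_k
      = (-1) ^+ l *: iter l (diff (- w)) (component s k - 'X_k)].
Proof.
move=> hs sj; elim: l => [|l [h1 h2 h3]]; first by rewrite scale1r.
have [h4 h5] := comp_commu w h1 h2; split; [exact: unitri_commu| exact: h4|].
by rewrite !iterS h5 h3 diffZ exprS -scalerA scaleN1r.
Qed.

(** Enough differences kill the first nontrivial component; the next one is then treated in the same
    way. The induction is on the number r of components not yet known to be trivial. *)
Lemma commu_nilpotent (n : nat) (K : fieldType) (w : 'cV[K]_n) s :
  unitri s -> exists l, iter l (commu (tran w)) s = 1%g.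
Proof.
suff h k r : (k + r = n)%N -> forall s : GA n K, unitri s ->
    (forall j : 'I_n, (j < k)%N -> component s j = 'X_j) ->
    exists l, iter l (commu (tran w)) s = 1%g.
  by move=> hs; apply: (h 0%N n).
elim: r k => [|r IH] k kn s' hs sj.
  exists 0%N; apply: GA_ext => j; rewrite comp_GA1; apply: sj.
  by rewrite -[k]addn0 kn.
have kn' : (k < n)%N by rewrite -kn addnS ltnS leq_addr.
have [l hl] := diff_nilpotent (- w) (component s' (Ordinal kn') - 'X_(Ordinal kn')).
have [h1 h2 h3] := iter_commu (k := Ordinal kn') w l hs sj.
have [||l' hl'] := IH k.+1 _ _ h1; first by rewrite addSnnS.
  move=> j; rewrite ltnS leq_eqVlt => /orP[/eqP jk|]; last exact: h2.
  have -> : j = Ordinal kn' by apply: val_inj.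
  by apply/eqP; rewrite -subr_eq0 h3 hl scaler0.
by exists (l' + l)%N; rewrite iterD.
Qed.

Lemma commu_conj (gT : groupType) (rho t s : gT) l :
  iter l (commu (rho * t * rho^-1)%g) (rho * s * rho^-1)%g
  = (rho * iter l (commu t) s * rho^-1)%g.
Proof.
have e x : commu (rho * t * rho^-1)%g (rho * x * rho^-1)%g
    = (rho * commu t x * rho^-1)%g.
  by rewrite /commu !invgM !invgK !mulgA !(mulgVK rho).
by elim: l => // l IH; rewrite !iterS IH e.
Qed.

(** * Products of three triangular automorphisms *)

Definition col2 (K : fieldType) : 'cV[K]_3 := \col_j (j == i2)%:R.

(** No polynomial part of [tau] involves the last variable, so translations along it are only
    rescaled. *)
Lemma tri_tran (K : fieldType) (tau : GA 3 K) : triangular tau ->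
  exists2 u, u != 0 & forall d,
    (tau * tran (d *: col2 K) = tran ((u * d) *: col2 K) * tau)%g.
Proof.
case=> u [P h]; have [u0 _ _] := h i2; exists (u i2) => // d.
apply: GA_ext => i; have [ui /lowP lP ei] := h i.
rewrite !comp_GAM ei comp_tran !comp_mpolyD comp_mpolyZ !pullXc comp_tran.
have -> : P i \mPo GA_tuple (tran (d *: col2 K)) = P i.
  apply: (over_comp_id lP) => j ji; rewrite -pullX pullXc comp_tran !mxE.
  have -> : (j == i2) = false; last by rewrite mulr0 mpolyC0 addr0.
  by apply/negP => /eqP jj; move: ji (ltn_ord i); rewrite jj /=; lia.
rewrite ei comp_mpolyC !mxE scalerDr -!addrA; congr (_ + _).
rewrite addrC; congr (_ + _); rewrite -mul_mpolyC -mpolyCM.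
by case: eqVneq => [->|_]; rewrite ?mulr0 // mulrA.
Qed.

Lemma affine_tran_conj (n : nat) (K : fieldType) (alpha : GA n K) w :
  affine alpha -> (alpha * tran w = tran (jac0 alpha *m w) * alpha)%g.
Proof.
case/affineP=> uM ->; rewrite jac0_aff // /tran !affM ?unitmx1 //.
by rewrite mulmx1 !mul1mx addrC.
Qed.

(** If the commutator psi t psi^-1 t^-1 is affine then so is psi t psi^-1, and [affine_translate]
    applies to [psi]; affineness thus climbs back one commutator at a time. *)
Lemma commu_chain (K : fieldType) (G : GA 3 K -> Prop) l psi :
  [pchar K] =i pred0 -> over_affine G -> G psi ->
  affine (iter l (commu (elem i2 1)) psi) ->
  affine psi \/ forall xi, tame xi -> G xi.
Proof.
move=> hK hG; have [GAf GM GV] := hG.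
have at_ : affine (elem i2 1 : GA 3 K) by rewrite elem_tran; apply: affine_tran.
elim: l psi => [|l IH] psi Gpsi; first by left.
rewrite iterSr => /IH; case=> [||]; last by right.
  apply/(GM); last exact/GV/GAf.
  by apply/(GM); [apply/(GM)/GAf/at_/Gpsi | apply: GV].
move=> a; apply: (affine_translate hK hG Gpsi).
by rewrite -[(psi * _ * _)%g](mulgVK (elem i2 1)); apply: affine_mul.
Qed.

Lemma three_triangular (K : fieldType) (G : GA 3 K -> Prop) t1 a1 t2 a2 t3 :
  [pchar K] =i pred0 -> over_affine G ->
  triangular t1 -> affine a1 -> triangular t2 -> affine a2 -> triangular t3 ->
  G (t1 * a1 * t2 * a2 * t3)%g ->
  affine (t1 * a1 * t2 * a2 * t3)%g \/ forall xi, tame xi -> G xi.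
Proof.
move=> hK hG h1 ha1 h2 ha2 h3; set phi := (_ * t3)%g => Gphi.
have [GAf GM GV] := hG; set t : GA 3 K := elem i2 1.
have et : t = tran (col2 K) by apply: elem_tran.
have at_ : affine t by rewrite et; apply: affine_tran.
have [u3 u30 /(_ 1)] := tri_tran h3; rewrite mulr1 scale1r -et => e3.
have [u1 u10 /(_ u1^-1)] := tri_tran h1; rewrite mulfV // scale1r -et => e1.
(* Moving t leftwards through [t3] and [a2] turns it into the translation by [v]; [w] is chosen so
   that conjugation by [t1 * a1] turns the translation by [w] into t. *)
pose v := jac0 a2 *m (u3 *: col2 K); pose w := invmx (jac0 a1) *m (u1^-1 *: col2 K).
pose rho := (t1 * a1)%g.
have et' : t = (rho * tran w * rho^-1)%g.
  have [uM _] := affineP ha1.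
  have ew : jac0 a1 *m w = u1^-1 *: col2 K by rewrite mulmxA mulmxV // mul1mx.
  rewrite /rho -mulgA -(mulgA t1) (mulgA a1) affine_tran_conj // ew.
  by rewrite invgM -(mulgA (tran _)) mulVKg mulgA e1 mulgK.
have e2 := affine_tran_conj (u3 *: col2 K) ha2; rewrite -/v in e2.
pose s0 := (t2 * tran v * t2^-1)%g.
have epsi : (phi * t * phi^-1 = rho * s0 * rho^-1)%g.
  have -> : phi = (rho * (t2 * (a2 * t3)))%g by rewrite /phi /rho !mulgA.
  rewrite !invgM -!mulgA (mulgA t3) e3 -!mulgA (mulgA a2) e2 -!mulgA.
  by rewrite mulVKg mulVKg /s0 !mulgA.
have [l hl] := commu_nilpotent w (tri_conj_tran v h2).
have Gpsi : G (phi * t * phi^-1)%g.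
  by apply/(GM); [apply/(GM)/GAf/at_/Gphi | apply: GV].
have apsi : affine (iter l (commu t) (phi * t * phi^-1)%g).
  by rewrite epsi {1}et' commu_conj hl mulg1 mulgV; apply: affine1.
have [a|] := commu_chain hK hG Gpsi apsi; last by right.
exact: (affine_translate hK hG Gphi a).
Qed.

(** The product is padded with identities, which are both affine and triangular. *)
Lemma m_triangular_le (n : nat) (K : fieldType) m m' (phi : GA n K) :
  (m <= m')%N -> m_triangular m phi -> m_triangular m' phi.
Proof.
move=> mm [alpha [tau [ha ht e]]].
exists (fun i => if (i <= m)%N then alpha i else 1%g).
exists (fun i => if (i <= m)%N then tau i else 1%g).
split=> [i _|i /andP[i0 _]|].
- by case: ifP => [/ha//|_]; apply: affine1.
- case: ifP => im; first by apply: ht; rewrite i0.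
  exists (fun=> 1), (fun=> 0) => j; split; first exact: oner_neq0.
    by move=> mu; rewrite msupp0.
  by rewrite comp_GA1 scale1r addr0.
rewrite leq0n (big_cat_nat (n := m.+1)) //=.
rewrite [X in (_ * (_ * X))%g]big_nat_cond [X in (_ * (_ * X))%g]big1.
  rewrite mulg1 e; apply: (congr1 (fun x => alpha 0%N * x)%g).
  by apply: eq_big_nat => i /andP[_]; rewrite ltnS => ->.
by move=> i /andP[/andP[mi _] _]; rewrite leqNgt mi mulg1.
Qed.

Lemma over_affine_generated (n : nat) (K : fieldType) (phi : GA n K) :
  over_affine (generated (fun g => g = phi \/ affine g)).
Proof.
split=> [psi h||]; first by apply: gen_incl; right.
  exact: gen_mul.
exact: gen_inv.
Qed.

Lemma cotame_le3 (K : fieldType) m (phi : GA 3 K) :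
  [pchar K] =i pred0 -> (m <= 3)%N -> m_triangular m phi ->
  affine phi \/ cotame phi.
Proof.
move=> hK m3 /(m_triangular_le m3)[al [tau [ha ht e]]].
have hG := over_affine_generated phi; have [GAf GM GV] := hG.
have Gphi : generated (fun g => g = phi \/ affine g) phi by apply: gen_incl; left.
have e' : phi = (al 0%N * (tau 1%N * al 1%N * tau 2%N * al 2%N * tau 3%N) * al 3%N)%g.
  by rewrite e big_ltn // big_ltn // big_ltn // big_geq // mulg1 !mulgA.
set phi' := (_ * tau 3%N)%g in e'.
have ephi' : phi' = ((al 0%N)^-1 * phi * (al 3%N)^-1)%g.
  by rewrite e' !mulgA mulVg mul1g mulgK.
have G' : generated (fun g => g = phi \/ affine g) phi'.
  rewrite ephi'; apply/(GM); last exact/GV/GAf/ha.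
  by apply/(GM)/Gphi/GV/GAf/ha.
have [a|] := three_triangular hK hG (ht 1%N isT) (ha 1%N isT) (ht 2%N isT)
  (ha 2%N isT) (ht 3%N isT) G'; last by right.
left; rewrite e'; apply: affine_mul (ha 3%N isT).
exact: affine_mul (ha 0%N isT) a.
Qed.

(** * Degrees *)

(** The zero polynomial gets degree 0 like the other constants, so positive degree means
    nonconstant. *)
Definition dg (n : nat) (K : fieldType) (p : {mpoly K[n]}) := (msize p).-1.

Lemma dg_neq0 (n : nat) (K : fieldType) (p : {mpoly K[n]}) :
  (0 < dg p)%N -> p != 0.
Proof. by rewrite -msize_poly_eq0 /dg; case: (msize p). Qed.

Lemma dgC (n : nat) (K : fieldType) c : dg (c%:MP : {mpoly K[n]}) = 0%N.
Proof. by rewrite /dg msizeC; case: (c != 0). Qed.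

Lemma dgM (n : nat) (K : fieldType) (p q : {mpoly K[n]}) :
  p != 0 -> q != 0 -> dg (p * q) = (dg p + dg q)%N.
Proof.
move=> p0 q0; rewrite /dg msizeM //.
move: p0 q0; rewrite -msize_poly_eq0 -[q == 0]msize_poly_eq0.
by case: (msize p) => // a _; case: (msize q) => // b _; rewrite addnS.
Qed.

Lemma dgM_le (n : nat) (K : fieldType) (p q : {mpoly K[n]}) :
  (dg (p * q) <= dg p + dg q)%N.
Proof.
have [->|p0] := eqVneq p 0; first by rewrite mul0r /dg msize0.
have [->|q0] := eqVneq q 0; first by rewrite mulr0 /dg msize0.
by rewrite dgM.
Qed.

Lemma dgCM (n : nat) (K : fieldType) c (p : {mpoly K[n]}) :
  c != 0 -> dg (c%:MP * p) = dg p.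
Proof. by move=> c0; rewrite mul_mpolyC /dg msizeZ. Qed.

Lemma dgCM_le (n : nat) (K : fieldType) c (p : {mpoly K[n]}) :
  (dg (c%:MP * p)%R <= dg p)%N.
Proof. by rewrite (leq_trans (dgM_le _ _)) // dgC. Qed.

Lemma dgX (n : nat) (K : fieldType) (p : {mpoly K[n]}) k :
  p != 0 -> dg (p ^+ k) = (k * dg p)%N.
Proof.
move=> p0; elim: k => [|k IH]; first by rewrite expr0 -mpolyC1 dgC.
by rewrite exprS dgM ?expf_neq0 // IH mulSn.
Qed.

Lemma dgX_le (n : nat) (K : fieldType) (p : {mpoly K[n]}) k :
  (dg (p ^+ k) <= k * dg p)%N.
Proof.
elim: k => [|k IH]; first by rewrite expr0 -mpolyC1 dgC.
by rewrite exprS mulSn (leq_trans (dgM_le _ _)) // leq_add2l.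
Qed.

Lemma dgN (n : nat) (K : fieldType) (p : {mpoly K[n]}) : dg (- p) = dg p.
Proof. by rewrite /dg msizeN. Qed.

Lemma dgD_le (n : nat) (K : fieldType) (p q : {mpoly K[n]}) :
  (dg (p + q) <= maxn (dg p) (dg q))%N.
Proof. by rewrite /dg; have := msizeD_le p q; lia. Qed.

Lemma dgD_leP (n : nat) (K : fieldType) (p q : {mpoly K[n]}) k :
  (dg p <= k)%N -> (dg q <= k)%N -> (dg (p + q) <= k)%N.
Proof. by move=> hp hq; rewrite (leq_trans (dgD_le _ _)) // geq_max hp. Qed.

Lemma dgD_l (n : nat) (K : fieldType) (p q : {mpoly K[n]}) :
  (dg q < dg p)%N -> dg (p + q) = dg p.
Proof.
move=> qp; have := dgD_le p q; have := dgD_le (p + q) (- q).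
by rewrite addrK dgN; lia.
Qed.

Lemma dgD_r (n : nat) (K : fieldType) (p q : {mpoly K[n]}) :
  (dg p < dg q)%N -> dg (p + q) = dg q.
Proof. by rewrite addrC; apply: dgD_l. Qed.

(** A nonzero multiple of a nonconstant [h] is nonconstant and cannot cancel a constant. Iterated on
    Horner forms, this compares coefficients of polynomials in [h]. *)
Lemma horner0 (n : nat) (K : fieldType) c (h r : {mpoly K[n]}) :
  (0 < dg h)%N -> c%:MP + h * r = 0 -> c = 0 /\ r = 0.
Proof.
move=> h0; have hn := dg_neq0 h0; have [->|r0] := eqVneq r 0.
  rewrite mulr0 addr0 => /(congr1 (mcoeff 0%MM)).
  by rewrite mcoeffC eqxx mulr1 mcoeff0.
move=> e; have := @dgD_r _ _ c%:MP (h * r); rewrite e dgM // dgC /dg msize0.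
by move: h0; rewrite /dg; lia.
Qed.

(** * The ping-pong argument *)

Definition Ppol (n : nat) (K : fieldType) (y z : {mpoly K[n]}) :=
  y ^+ 2 * z ^+ 3 + y * z.

(* The shape of the components of theta * psi; X and Y are the last two
   components of s sR s sP psi. *)
Definition pong (n : nat) (K : fieldType) (h g f : {mpoly K[n]}) :=
  exists X Y, [/\ f = X - Ppol g h, g = Y - X ^+ 2 * h
    & [/\ (0 < dg h)%N, (3 * dg h <= dg X)%N & (dg Y <= dg X)%N]].

Lemma dg_Ppol (n : nat) (K : fieldType) (g h : {mpoly K[n]}) :
  (0 < dg g)%N -> (0 < dg h)%N -> dg (Ppol g h) = (2 * dg g + 3 * dg h)%N.
Proof.
move=> g0 h0; have gn := dg_neq0 g0; have hn := dg_neq0 h0.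
have e : dg (g ^+ 2 * h ^+ 3) = (2 * dg g + 3 * dg h)%N.
  by rewrite dgM ?expf_neq0 // !dgX.
by rewrite dgD_l e // dgM //; lia.
Qed.

(** The terms X^2 h and g^2 h^3 dominate, so degrees strictly increase from [h] to [g] to [f]. *)
Lemma dg_pong (n : nat) (K : fieldType) (h g f X Y : {mpoly K[n]}) :
  f = X - Ppol g h -> g = Y - X ^+ 2 * h ->
  (0 < dg h)%N -> (3 * dg h <= dg X)%N -> (dg Y <= dg X)%N ->
  dg g = (2 * dg X + dg h)%N /\ dg f = (2 * dg g + 3 * dg h)%N.
Proof.
move=> ef eg h0 X3 YX; have hn := dg_neq0 h0.
have Xn : X != 0 by apply: dg_neq0; lia.
have e : dg (X ^+ 2 * h) = (2 * dg X + dg h)%N.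
  by rewrite dgM ?expf_neq0 // dgX.
have eg' : dg g = (2 * dg X + dg h)%N by rewrite eg dgD_r dgN e //; lia.
split=> //; have g0 : (0 < dg g)%N by lia.
by rewrite ef dgD_r dgN dg_Ppol //; lia.
Qed.

(** Here l0, l1, l2 are the components of the map that [theta] multiplies on the left. The bounds
    make Y^2 l0 dominate in X, whence deg X = 2 deg Y + deg l0 >= 3 deg l0. *)
Lemma pong_of (n : nat) (K : fieldType) (l0 l1 l2 X Y : {mpoly K[n]}) :
  Y = l2 + Ppol l1 l0 -> X = l1 + Y ^+ 2 * l0 ->
  (0 < dg l0)%N -> (dg l0 <= dg Y)%N -> (dg l1 < 2 * dg Y + dg l0)%N ->
  pong l0 (Y - X ^+ 2 * l0) (X - Ppol (Y - X ^+ 2 * l0) l0).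
Proof.
move=> eY eX h0 hY hl; have ln := dg_neq0 h0.
have Yn : Y != 0 by apply: dg_neq0; lia.
have e : dg (Y ^+ 2 * l0) = (2 * dg Y + dg l0)%N.
  by rewrite dgM ?expf_neq0 // dgX.
have eX' : dg X = (2 * dg Y + dg l0)%N by rewrite eX dgD_r e.
by exists X, Y; split=> //; split=> //; lia.
Qed.

Lemma pong_generic (n : nat) (K : fieldType) (l0 l1 l2 X Y : {mpoly K[n]}) :
  Y = l2 + Ppol l1 l0 -> X = l1 + Y ^+ 2 * l0 ->
  (0 < dg l0)%N -> (0 < dg l1)%N -> (dg l2 < 2 * dg l1 + 3 * dg l0)%N ->
  pong l0 (Y - X ^+ 2 * l0) (X - Ppol (Y - X ^+ 2 * l0) l0).
Proof.
move=> eY eX h0 h1 h2; have eP := dg_Ppol h1 h0.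
have eY' : dg Y = (2 * dg l1 + 3 * dg l0)%N by rewrite eY dgD_r eP.
by apply: (pong_of eY eX) => //; lia.
Qed.

Lemma horner2 (n : nat) (K : fieldType) c0 c1 (h : {mpoly K[n]}) :
  (0 < dg h)%N -> c0%:MP + h * c1%:MP = 0 -> c0 = 0 /\ c1 = 0.
Proof.
move=> h0 /(horner0 h0)[-> /eqP]; rewrite mpolyC_eq0 => /eqP.
by [].
Qed.

Lemma horner4 (n : nat) (K : fieldType) c0 c1 c2 c3 (h : {mpoly K[n]}) :
  (0 < dg h)%N ->
  c0%:MP + h * (c1%:MP + h * (c2%:MP + h * c3%:MP)) = 0 ->
  [/\ c0 = 0, c1 = 0, c2 = 0 & c3 = 0].
Proof. by move=> h0 /(horner0 h0)[-> /(horner0 h0)[-> /(horner2 h0)[-> ->]]]. Qed.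

Lemma dg_lin (n : nat) (K : fieldType) c d (h : {mpoly K[n]}) :
  c != 0 -> (0 < dg h)%N -> dg (c%:MP * h + d%:MP) = dg h.
Proof. by move=> c0 h0; rewrite dgD_l dgCM // dgC. Qed.

(** The case where leading terms may cancel: a lower triangular affine map acts on a triple (h, g,
    f). Either enough degree survives or all cancellations occur at once, and then u = v^2 w^3, u =
    v w and v = u^2 w force the map to be the identity. The two terms of [Ppol] supply the first two
    equations. *)
Lemma pong_triangular (n : nat) (K : fieldType) (h g f l0 l1 l2 X Y : {mpoly K[n]})
    (u v w a b c e c1 c0 : K) :
  [pchar K] =i pred0 -> pong h g f -> u != 0 -> v != 0 -> w != 0 ->
  l0 = w%:MP * h + c0%:MP -> l1 = v%:MP * g + e%:MP * h + c1%:MP ->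
  l2 = u%:MP * f + a%:MP * g + b%:MP * h + c%:MP ->
  Y = l2 + Ppol l1 l0 -> X = l1 + Y ^+ 2 * l0 ->
  pong l0 (Y - X ^+ 2 * l0) (X - Ppol (Y - X ^+ 2 * l0) l0)
  \/ [/\ u = 1, v = 1 & w = 1] /\
     [/\ a = 0, b = 0, c = 0 & [/\ e = 0, c1 = 0 & c0 = 0]].
Proof.
move=> hK [X0 [Y0 [ef eg [h0 X3 YX]]]] u0 v0 w0 e0 e1 e2 eY eX.
have [dgg dgf] := dg_pong ef eg h0 X3 YX.
have hn := dg_neq0 h0; have gn : g != 0 by apply: dg_neq0; lia.
have dl0 : dg l0 = dg h by rewrite e0 dg_lin.
have dl1 : dg l1 = dg g.
  by rewrite e1 -addrA dgD_l dgCM // (leq_ltn_trans (dgD_le _ _)) // dgC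
    maxn0 (leq_ltn_trans (dgCM_le _ _)) //; lia.
(* Coefficients in K[h] of [Y] as a quadratic expression in [g]; X0 enters only the constant term.
   If [s2] or [s1] is nonzero, [Y] has degree at least deg g. *)
pose s2 := v%:MP ^+ 2 * l0 ^+ 3 - u%:MP * h ^+ 3.
pose m := e%:MP * h + c1%:MP.
pose s1 := 2%:R * v%:MP * m * l0 ^+ 3 + v%:MP * l0 - u%:MP * h + a%:MP.
pose s0 := m ^+ 2 * l0 ^+ 3 + m * l0 + b%:MP * h + c%:MP.
have eY' : Y = s2 * g ^+ 2 + (s1 * g + (u%:MP * X0 + s0)).
  by rewrite eY e2 e1 ef /Ppol /s2 /s1 /s0 /m; ring.
have dm : (dg m <= dg h)%N.
  by apply: dgD_leP; rewrite ?dgCM_le // dgC.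
have dl3 : (dg (l0 ^+ 3) <= 3 * dg h)%N by rewrite (leq_trans (dgX_le _ _)) // dl0.
have ds1 : (dg s1 <= 4 * dg h)%N.
  apply: dgD_leP; last by rewrite dgC.
  apply: dgD_leP; last first.
    by rewrite dgN (leq_trans (dgCM_le _ _)) //; lia.
  apply: dgD_leP; last by rewrite (leq_trans (dgCM_le _ _)) // dl0; lia.
  rewrite (leq_trans (dgM_le _ _)) //.
  have h2 : (dg ((2%:R : {mpoly K[n]}) * v%:MP * m) <= dg h)%N.
    rewrite (leq_trans (dgM_le _ _)) // -mpolyC_nat -mpolyCM dgC.
    exact: dm.
  lia.
have ds0 : (dg s0 <= 5 * dg h)%N.
  apply: dgD_leP; last by rewrite dgC.
  apply: dgD_leP; last by rewrite (leq_trans (dgCM_le _ _)) //; lia.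
  apply: dgD_leP; rewrite (leq_trans (dgM_le _ _)) // ?dl0; last by lia.
  by have := dgX_le m 2; lia.
have dr : (dg (u%:MP * X0 + s0) <= maxn (dg X0) (5 * dg h))%N.
  by apply: dgD_leP; [have := dgCM_le u X0; lia | lia].
have [s20|s20] := eqVneq s2 0; last first.
  left; have e2' : dg (s2 * g ^+ 2) = (dg s2 + 2 * dg g)%N.
    by rewrite dgM ?expf_neq0 // dgX.
  have eY2 : dg Y = (dg s2 + 2 * dg g)%N.
    rewrite eY' dgD_l e2' // (leq_ltn_trans (dgD_le _ _)) // gtn_max.
    by apply/andP; split; [have := dgM_le s1 g; lia | lia].
  by apply: (pong_of eY eX); rewrite ?dl0 ?dl1 ?eY2 //; lia.
have [s10|s10] := eqVneq s1 0; last first.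
  left; have eY2 : dg Y = (dg s1 + dg g)%N.
    by rewrite eY' s20 mul0r add0r dgD_l dgM //; lia.
  by apply: (pong_of eY eX); rewrite ?dl0 ?dl1 ?eY2 //; lia.
have [h20 h21 h22 h23] : [/\ v ^+ 2 * c0 ^+ 3 = 0, 3%:R * v ^+ 2 * w * c0 ^+ 2 = 0,
    3%:R * v ^+ 2 * w ^+ 2 * c0 = 0 & v ^+ 2 * w ^+ 3 - u = 0].
  by apply: (horner4 h0); rewrite -s20 /s2 e0; ring.
have c00 : c0 = 0.
  have nz : 3%:R * v ^+ 2 * w ^+ 2 != 0.
    by rewrite !mulf_neq0 // (natr_neq0 hK).
  by move/eqP: h22; rewrite mulf_eq0 (negPf nz) => /eqP.
have l0E : l0 = w%:MP * h by rewrite e0 c00 mpolyC0 addr0.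
(* Coefficients of 1, h, h^2, h^3, h^4 in [s1] once c0 = 0; the one of h^2 is zero. *)
have [a0 [vwu [_ [c1e ee]]]] : a = 0 /\ v * w - u = 0 /\ (0 : K) = 0 /\
    2%:R * v * w ^+ 3 * c1 = 0 /\ 2%:R * v * w ^+ 3 * e = 0.
  have : a%:MP + h * ((v * w - u)%:MP + h * (0%:MP + h *
      ((2%:R * v * w ^+ 3 * c1)%:MP + h * (2%:R * v * w ^+ 3 * e)%:MP))) = 0.
    by rewrite -s10 /s1 /m l0E mpolyC0; ring.
  move/(horner0 h0) => [-> /(horner4 h0)[-> _ -> ->]].
  by [].
have nz : 2%:R * v * w ^+ 3 != 0.
  by rewrite !mulf_neq0 // ?(natr_neq0 hK) // expf_neq0.
have c10 : c1 = 0 by move/eqP: c1e; rewrite mulf_eq0 (negPf nz) => /eqP.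
have e00 : e = 0 by move/eqP: ee; rewrite mulf_eq0 (negPf nz) => /eqP.
have l1E : l1 = v%:MP * g by rewrite e1 c10 e00 mpolyC0 mul0r !addr0.
pose q := b%:MP * h + c%:MP.
have YE : Y = u%:MP * X0 + q.
  rewrite eY' s20 s10 !mul0r !add0r /s0 /m c10 e00 mpolyC0 /q; ring.
have dq : (dg q <= dg h)%N by apply: dgD_leP; rewrite ?dgCM_le // dgC.
have Xn : X0 != 0 by apply: dg_neq0; lia.
have dY : dg Y = dg X0 by rewrite YE dgD_l dgCM //; lia.
have XE : X = (u ^+ 2 * w - v)%:MP * (h * X0 ^+ 2)
    + ((2%:R * u * w)%:MP * (h * q * X0) + (w%:MP * (h * q ^+ 2) + v%:MP * Y0)).
  by rewrite eX l1E l0E YE eg; ring.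
have dhX : dg (h * X0 ^+ 2) = (dg h + 2 * dg X0)%N.
  by rewrite dgM ?expf_neq0 // dgX.
have dhq : (dg (w%:MP * (h * q ^+ 2)) <= 3 * dg h)%N.
  rewrite (leq_trans (dgCM_le _ _)) // (leq_trans (dgM_le _ _)) //.
  by have := dgX_le q 2; lia.
have dvY : (dg (v%:MP * Y0) <= dg X0)%N by rewrite dgCM.
(* Now [Y] has only the degree of X0, so the bounds must come from [X]. In [XE] the term h X0^2
   dominates if its coefficient is nonzero, otherwise h q X0 does if q is nonzero. *)
suff [dX|] : (dg h + dg X0 <= dg X)%N \/ u ^+ 2 * w - v = 0 /\ q = 0.
- by left; exists X, Y; split=> //; split; rewrite ?dl0 //; lia.
- move=> [uwv q0]; right.
  have [c00' b0] : c = 0 /\ b = 0 by apply: (horner2 h0); rewrite -q0 /q; ring.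
  have eu : u = v * w by apply/esym/eqP; rewrite -subr_eq0 vwu.
  have ev : v = u ^+ 2 * w by apply/esym/eqP; rewrite -subr_eq0 uwv.
  have eu' : u = v ^+ 2 * w ^+ 3 by apply/esym/eqP; rewrite -subr_eq0 h23.
  have uv : u = v by rewrite [RHS]ev [LHS]eu' eu; ring.
  have w1 : w = 1 by apply: (mulfI v0); rewrite -eu uv mulr1.
  have v1 : v = 1.
    by apply: (mulfI v0); rewrite mulr1 [RHS]ev uv w1 mulr1 expr2.
  by rewrite uv v1 w1.
have [uwv|uwv] := eqVneq (u ^+ 2 * w - v) 0; last first.
  left; rewrite XE dgD_l dgCM // dhX; first by lia.
  rewrite (leq_ltn_trans (dgD_le _ _)) // gtn_max; apply/andP; split.
    rewrite (leq_ltn_trans (dgCM_le _ _)) // (leq_ltn_trans (dgM_le _ _)) //.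
    by have := dgM_le h q; lia.
  by rewrite (leq_ltn_trans (dgD_le _ _)) // gtn_max; apply/andP; split; lia.
have [q0|q0] := eqVneq q 0; first by right.
left; rewrite XE uwv mpolyC0 mul0r add0r.
have nz2 : 2%:R * u * w != 0 by rewrite !mulf_neq0 ?(natr_neq0 hK).
have e3 : dg (h * q * X0) = (dg h + dg q + dg X0)%N.
  by rewrite !dgM ?mulf_neq0.
rewrite dgD_l dgCM // e3; first by lia.
by rewrite (leq_ltn_trans (dgD_le _ _)) // gtn_max; apply/andP; split; lia.
Qed.

Lemma dg_comb (n : nat) (K : fieldType) (h g f : {mpoly K[n]}) k0 k1 k2 c :
  (0 < dg h)%N -> (dg h < dg g)%N -> (dg g < dg f)%N ->
  dg (k0%:MP * h + k1%:MP * g + k2%:MP * f + c%:MP)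
  = if k2 != 0 then dg f else if k1 != 0 then dg g
    else if k0 != 0 then dg h else 0%N.
Proof.
move=> h0 hg gf.
have e0 : dg (k0%:MP * h + c%:MP) = if k0 != 0 then dg h else 0%N.
  case: eqVneq => [->|k00] /=; last exact: dg_lin.
  by rewrite mpolyC0 mul0r add0r dgC.
have e1 : dg (k0%:MP * h + k1%:MP * g + c%:MP)
    = if k1 != 0 then dg g else if k0 != 0 then dg h else 0%N.
  rewrite addrAC; case: (eqVneq k1 0) => [->|k10] /=.
    by rewrite mpolyC0 mul0r addr0.
  by rewrite dgD_r dgCM // e0; case: ifP => _; lia.
rewrite addrAC; case: (eqVneq k2 0) => [->|k20] /=.
  by rewrite mpolyC0 mul0r addr0.
by rewrite dgD_r dgCM // e1; case: ifP => _; [|case: ifP => _]; lia.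
Qed.

(** * The automorphism [theta] and its left action on components *)

Lemma comp_affM (K : fieldType) (M : 'M[K]_3) b (psi : GA 3 K) i :
  M \in unitmx ->
  component (aff M b * psi)%g i
  = (M i i0)%:MP * component psi i0 + (M i i1)%:MP * component psi i1
    + (M i i2)%:MP * component psi i2 + (b i 0)%:MP.
Proof.
move=> uM; rewrite comp_GAM comp_aff // /aff_comp sum3 !comp_mpolyD !comp_mpolyZ.
by rewrite comp_mpolyC !pullXc !mul_mpolyC.
Qed.

Lemma comp_elemM (n : nat) (K : fieldType) i p (psi : GA n K) j :
  over (other i) p ->
  component (elem i p * psi)%g j
  = component psi j + (if j == i then p \mPo GA_tuple psi else 0).
Proof.
move=> hp; rewrite comp_GAM comp_elem // comp_mpolyD pullXc.
by case: ifP; rewrite ?comp_mpoly0.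
Qed.

Lemma comp_pmapM (n : nat) (K : fieldType) s (psi : GA n K) j :
  component (pmap K s * psi)%g j = component psi (s j).
Proof. by rewrite comp_GAM comp_pmap pullXc. Qed.

Definition Pthe (K : fieldType) : {mpoly K[3]} := Ppol 'X_i1 'X_i0.
Definition Rthe (K : fieldType) : {mpoly K[3]} := 'X_i1 ^+ 2 * 'X_i0.
Definition swap12 (K : fieldType) : GA 3 K := pmap K (tperm i1 i2).

Definition theta (K : fieldType) : GA 3 K :=
  ((elem i2 (Pthe K))^-1 * (swap12 K * ((elem i2 (Rthe K))^-1 * (swap12 K *
   (elem i2 (Rthe K) * (swap12 K * elem i2 (Pthe K)))))))%g.

Lemma low_Pthe (K : fieldType) : low 2 (Pthe K).
Proof.
apply: overD; last by apply: overM; apply: lowX.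
by apply: overM; apply/overXn/lowX.
Qed.

Lemma low_Rthe (K : fieldType) : low 2 (Rthe K).
Proof. by apply: overM; [apply/overXn/lowX | apply: lowX]. Qed.

Lemma low2_other (K : fieldType) (p : {mpoly K[3]}) : low 2 p -> over (other i2) p.
Proof.
apply: sub_over => j j2; rewrite /other; apply: contraTneq j2 => ->.
by [].
Qed.

Lemma comp_theta (K : fieldType) (psi : GA 3 K) :
  let l0 := component psi i0 in let l1 := component psi i1 in
  let Y := component psi i2 + Ppol l1 l0 in let X := l1 + Y ^+ 2 * l0 in
  [/\ component (theta K * psi)%g i0 = l0,
      component (theta K * psi)%g i1 = Y - X ^+ 2 * l0
    & component (theta K * psi)%g i2 = X - Ppol (Y - X ^+ 2 * l0) l0].
Proof.
have oP := low2_other (low_Pthe K); have oR := low2_other (low_Rthe K).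
have oP' := overN oP; have oR' := overN oR.
have s0 : tperm i1 i2 i0 = i0 by rewrite tpermD.
have s1 : tperm i1 i2 i1 = i2 by rewrite tpermL.
have s2 : tperm i1 i2 i2 = i1 by rewrite tpermR.
have PE (xi : GA 3 K) :
    Pthe K \mPo GA_tuple xi = Ppol (component xi i1) (component xi i0).
  by rewrite /Pthe /Ppol comp_mpolyD !(rmorphM (comp_mpoly _)) /= !pullXc.
have RE (xi : GA 3 K) :
    Rthe K \mPo GA_tuple xi = component xi i1 ^+ 2 * component xi i0.
  by rewrite /Rthe rmorphM rmorphXn /= !pullXc.
rewrite /theta !elemV // -!mulgA.
(* The factors of [theta] are applied from the innermost outwards: [x1] carries Y, then [x2] carries
   X, and [x3] carries Y - X^2 l0 as its last component. *)
pose x1 := (elem i2 (Pthe K) * psi)%g.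
have [a0 a1 a2] : [/\ component x1 i0 = component psi i0,
   component x1 i1 = component psi i1
   & component x1 i2 = component psi i2 + Ppol (component psi i1) (component psi i0)].
  by rewrite /x1 !comp_elemM //= PE !addr0.
rewrite -/x1; clearbody x1; pose x2 := (elem i2 (Rthe K) * (swap12 K * x1))%g.
have [b0 b1 b2] : [/\ component x2 i0 = component x1 i0,
   component x2 i1 = component x1 i2
   & component x2 i2 = component x1 i1 + component x1 i2 ^+ 2 * component x1 i0].
  by rewrite /x2 !comp_elemM //= RE !comp_pmapM s0 s1 s2 !addr0.
rewrite -/x2; clearbody x2; pose x3 := (elem i2 (- Rthe K) * (swap12 K * x2))%g.
have [c0 c1 c2] : [/\ component x3 i0 = component x2 i0,
   component x3 i1 = component x2 i2
   & component x3 i2 = component x2 i1 - component x2 i2 ^+ 2 * component x2 i0].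
  by rewrite /x3 !comp_elemM //= comp_mpolyN RE !comp_pmapM s0 s1 s2 !addr0.
rewrite -/x3; clearbody x3; rewrite !comp_elemM //= comp_mpolyN PE
   !comp_pmapM s0 s1 s2 !addr0.
by rewrite c0 c1 c2 b0 b1 b2 a0 a1 a2.
Qed.

Definition GApong (K : fieldType) (psi : GA 3 K) :=
  pong (component psi i0) (component psi i1) (component psi i2).

Lemma dg_component (n : nat) (K : fieldType) (phi : GA n K) i :
  affine phi -> dg (component phi i) = 1%N.
Proof. by move=> a; rewrite /dg a. Qed.

Lemma GApong_affine (K : fieldType) (alpha : GA 3 K) :
  affine alpha -> GApong (theta K * alpha)%g.
Proof.
move=> a; have [e0 e1 e2] := comp_theta alpha; rewrite /GApong e0 e1 e2.
by apply: (pong_generic erefl erefl); rewrite !dg_component.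
Qed.

(** If l2 has small degree, no cancellation occurs and [pong_generic] applies. Otherwise the matrix
    of [alpha] is lower triangular and [pong_triangular] applies, its exceptional case being alpha =
    1. *)
Lemma GApong_step (K : fieldType) (alpha psi : GA 3 K) :
  [pchar K] =i pred0 -> affine alpha -> alpha <> 1%g -> GApong psi ->
  GApong (theta K * (alpha * psi))%g.
Proof.
move=> hK aff_al al1 hp; have hp' := hp.
case: hp' => X0 [Y0 [ef eg [h0 X3 YX]]]; have [dgg dgf] := dg_pong ef eg h0 X3 YX.
have [uM eal] := affineP aff_al; move: (jac0 _) (val0 _) uM eal => M b uM eal.
have hg : (dg (component psi i0) < dg (component psi i1))%N by lia.
have gf : (dg (component psi i1) < dg (component psi i2))%N by lia.
have [e0 e1 e2] := comp_theta (alpha * psi)%g; rewrite /GApong e0 e1 e2 {e0 e1 e2}.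
have dl i := dg_comb (M i i0) (M i i1) (M i i2) (b i 0) h0 hg gf.
have el i := comp_affM b psi i uM; rewrite -eal in el.
have row0 i : [|| M i i0 != 0, M i i1 != 0 | M i i2 != 0].
  apply/negPn; rewrite !negb_or !negbK; apply/negP => /and3P[/eqP z0 /eqP z1 /eqP z2].
  have /matrixP/(_ i i) := mulmxV uM; rewrite !mxE sum3 z0 z1 z2 !mul0r !addr0 eqxx.
  by move/eqP; rewrite eq_sym oner_eq0.
have dl_ge i : (dg (component psi i0) <= dg (component (alpha * psi)%g i))%N.
  rewrite el dl; have := row0 i.
  by case: (M i i2 == 0); case: (M i i1 == 0); case: (M i i0 == 0) => //= _; lia.
have dl_le i : (dg (component (alpha * psi)%g i) <= dg (component psi i2))%N.
  rewrite el dl.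
  by case: (M i i2 == 0); case: (M i i1 == 0); case: (M i i0 == 0) => /=; lia.
have [hh|hh] := ltnP (dg (component psi i2))
  (2 * dg (component (alpha * psi)%g i1) + 3 * dg (component (alpha * psi)%g i0)).
  apply: (pong_generic erefl erefl).
  - exact: leq_trans h0 (dl_ge _).
  - exact: leq_trans h0 (dl_ge _).
  exact: leq_ltn_trans (dl_le _) hh.
have ge0 := dl_ge i0; have ge1 := dl_ge i1.
(* Since deg f = 2 deg g + 3 deg h with deg h < deg g < deg f, any nonzero entry above the diagonal
   would make 2 deg l1 + 3 deg l0 exceed deg f. *)
have M12 : M i1 i2 = 0.
  apply/eqP; apply: contraLR hh => M12.
  by move: (el i1) (dl i1) => -> ->; rewrite M12; lia.
have M02 : M i0 i2 = 0.
  apply/eqP; apply: contraLR hh => M02.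
  by move: (el i0) (dl i0) => -> ->; rewrite M02; lia.
have M01 : M i0 i1 = 0.
  apply/eqP; apply: contraLR hh => M01.
  by move: (el i0) (dl i0) => -> ->; rewrite M02 eqxx M01 /=; lia.
have tM : is_trig_mx M.
  by apply/is_trig_mxP; elim/ord3_ind; elim/ord3_ind.
have := uM; rewrite unitmxE unitfE det_trig // prod3 !mulf_eq0 !negb_or.
move=> /andP[/andP[w0 v0] u0].
have E0 : component (alpha * psi)%g i0
    = (M i0 i0)%:MP * component psi i0 + (b i0 0)%:MP.
  by rewrite el M01 M02 mpolyC0 !mul0r !addr0.
have E1 : component (alpha * psi)%g i1 = (M i1 i1)%:MP * component psi i1
    + (M i1 i0)%:MP * component psi i0 + (b i1 0)%:MP.
  by rewrite el M12 mpolyC0 mul0r addr0 [(M i1 i0)%:MP * _ + _]addrC.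
have E2 : component (alpha * psi)%g i2 = (M i2 i2)%:MP * component psi i2
    + (M i2 i1)%:MP * component psi i1 + (M i2 i0)%:MP * component psi i0
    + (b i2 0)%:MP.
  by rewrite el; ring.
have [//|] := pong_triangular hK hp u0 v0 w0 E0 E1 E2 erefl erefl.
move=> [[u1 v1 w1] [a0 b0 c0 [z0 z1 z2]]]; case: al1.
have -> : alpha = aff M b by [].
rewrite -aff1; congr aff.
  by apply/matrixP; elim/ord3_ind; elim/ord3_ind; rewrite mxE.
by apply/matrixP => + j; rewrite ord1; elim/ord3_ind; rewrite mxE.
Qed.

(** * Reduced words in [theta] and the affine maps *)

Inductive pong_word (K : fieldType) : GA 3 K -> Prop :=
| PongStart alpha : affine alpha -> pong_word (theta K * alpha)%g
| PongStep alpha psi : affine alpha -> alpha <> 1%g -> pong_word psi ->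
    pong_word (theta K * (alpha * psi))%g.

Lemma pong_wordP (K : fieldType) (psi : GA 3 K) : [pchar K] =i pred0 ->
  pong_word psi -> GApong psi.
Proof.
move=> hK; elim=> [al a|al xi a al1 _ IH]; first exact: GApong_affine.
exact: GApong_step.
Qed.

Lemma swap12K (K : fieldType) : (swap12 K * swap12 K = 1)%g.
Proof. by apply: GA_ext => i; rewrite comp_pmapM comp_pmap comp_GA1 tpermK. Qed.

(** [theta] is the conjugate of the involution [swap12] by sR s sP. *)
Lemma theta2 (K : fieldType) : (theta K * theta K = 1)%g.
Proof.
rewrite /theta -!mulgA !mulVKg; set s := swap12 K.
have sK x : (s * (s * x) = x)%g by rewrite mulgA swap12K mul1g.
by rewrite !(sK, mulVKg, mulKg) mulVg.
Qed.

Definition affine_or_word (K : fieldType) (g : GA 3 K) :=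
  affine g \/ exists alpha psi, [/\ affine alpha, pong_word psi & g = (alpha * psi)%g].

(** When the affine letter in front is 1, two copies of [theta] meet and cancel, so the interior
    letters of words stay nontrivial, as [PongStep] demands. *)
Lemma affine_or_word_theta (K : fieldType) (g : GA 3 K) :
  affine_or_word g -> affine_or_word (theta K * g)%g.
Proof.
have W1 psi : pong_word psi -> affine_or_word psi.
  by move=> w; right; exists 1%g, psi; split; rewrite ?mul1g //; apply: affine1.
case=> [a|[al [psi [a w ->]]]]; first by apply/W1/PongStart.
have [->|/eqP al1] := eqVneq al 1%g; last exact/W1/PongStep.
rewrite mul1g; case: w => [be b|be xi b _ w].
  by left; rewrite mulgA theta2 mul1g.
by right; exists be, xi; split=> //; rewrite mulgA theta2 mul1g.
Qed.

Lemma affine_or_word_affine (K : fieldType) (al g : GA 3 K) :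
  affine al -> affine_or_word g -> affine_or_word (al * g)%g.
Proof.
move=> a [b|[be [psi [b w ->]]]]; first by left; apply: affine_mul.
by right; exists (al * be)%g, psi; split; rewrite ?mulgA //; apply: affine_mul.
Qed.

Lemma generated_affine_or_word (K : fieldType) (g : GA 3 K) :
  generated (fun h => h = theta K \/ affine h) g -> affine_or_word g.
Proof.
(* Stability under left multiplication by [g] and by its inverse are proved together, so that the
   induction passes through inverses. *)
move=> hg; suff [h _] : (forall x, affine_or_word x -> affine_or_word (g * x)%g) /\
    (forall x, affine_or_word x -> affine_or_word (g^-1 * x)%g).
  by rewrite -[g]mulg1; apply: h; left; apply: affine1.
elim: hg => {g} [g [->|a]||x y _ [h1 h2] _ [h3 h4]|x _ [h1 h2]].
- have -> : (theta K)^-1%g = theta K by apply: mulg1_eq; apply: theta2.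
  by split; apply: affine_or_word_theta.
- by split=> x; apply: affine_or_word_affine => //; apply: affine_inv.
- by split=> x; rewrite ?invg1 mul1g.
- by split=> z hz; rewrite ?invgM -mulgA; [apply/h1/h3 | apply/h4/h2].
by rewrite invgK.
Qed.

(** Left multiplication by an affine map does not raise the maximal degree of the components, while
    deg h >= 1 and deg X >= 3 force deg g >= 7 and deg f >= 17 in a triple of [pong]. *)
Lemma affine_or_word_small (K : fieldType) (g : GA 3 K) : [pchar K] =i pred0 ->
  (forall i, dg (component g i) <= 2)%N -> affine_or_word g -> affine g.
Proof.
move=> hK g2 [//|[al [psi [a /(pong_wordP hK) hp e]]]].
have epsi : psi = (al^-1 * g)%g by rewrite e mulKg.
have [uM eal] := affineP (affine_inv a).
case: hp => X [Y [ef eg [h0 X3 YX]]]; have [dgg dgf] := dg_pong ef eg h0 X3 YX.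
have : (dg (component psi i2) <= 2)%N.
  rewrite epsi eal comp_affM //.
  by do !apply: dgD_leP; rewrite ?dgC // (leq_trans (dgCM_le _ _)).
lia.
Qed.

(** * [theta] is 4-triangular but neither affine nor co-tame *)

Lemma triangular_elem2 (K : fieldType) (p : {mpoly K[3]}) :
  low 2 p -> triangular (elem i2 p).
Proof.
move=> lp; have op := low2_other lp.
exists (fun=> 1), (fun i => if i == i2 then p else 0) => i; split.
- exact: oner_neq0.
- apply/lowP; case: eqP => [->|_]; first exact: lp.
  by rewrite -mpolyC0; apply: overC.
by rewrite comp_elem // scale1r.
Qed.

Lemma theta_not_affine (K : fieldType) : ~ affine (theta K).
Proof.
move=> a; have := GApong_affine (@affine1 3 K); rewrite mulg1.
move=> [X [Y [ef eg [h0 X3 YX]]]].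
have [_] := dg_pong ef eg h0 X3 YX; rewrite !dg_component //.
Qed.

Lemma theta_not_cotame (K : fieldType) : [pchar K] =i pred0 -> ~ cotame (theta K).
Proof.
move=> hK ct; pose q : {mpoly K[3]} := 'X_i1 ^+ 2.
have lq : low 2 q by apply/overXn/lowX.
have oq := low2_other lq.
have eq_ : dg (component (elem i2 q) i2) = 2%N.
  by rewrite comp_elem // eqxx /q mpolyXn dgD_r /dg !msizeX ?mdegMn !mdeg1.
have w : affine_or_word (elem i2 q).
  by apply/generated_affine_or_word/ct/gen_incl; right; apply: triangular_elem2.
suff /(affine_or_word_small hK)/(_ w)/(dg_component i2) :
    forall i, (dg (component (elem i2 q) i) <= 2)%N by rewrite eq_.
move=> i; rewrite comp_elem //; case: (eqVneq i i2) => [->|_].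
  by have := eq_; rewrite comp_elem // eqxx => ->.
by rewrite addr0 /dg msizeX mdeg1.
Qed.

Lemma theta_4_triangular (K : fieldType) : m_triangular 4 (theta K).
Proof.
have tP : triangular (elem i2 (Pthe K)) by apply/triangular_elem2/low_Pthe.
have tR : triangular (elem i2 (Rthe K)) by apply/triangular_elem2/low_Rthe.
have tP' : triangular (elem i2 (Pthe K))^-1%g.
  by rewrite elemV; [apply/triangular_elem2/overN/low_Pthe | apply/low2_other/low_Pthe].
have tR' : triangular (elem i2 (Rthe K))^-1%g.
  by rewrite elemV; [apply/triangular_elem2/overN/low_Rthe | apply/low2_other/low_Rthe].
have as_ : affine (swap12 K) by apply: affine_pmap.
have a1 : affine (1%g : GA 3 K) by apply: affine1.
(* The outer affine factors are trivial; entry 0 of the second list is a dummy, since the triangular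
   factors are numbered from 1. *)
exists (fun i => nth 1%g [:: 1%g; swap12 K; swap12 K; swap12 K; 1%g] i).
exists (fun i => nth 1%g [:: 1%g; (elem i2 (Pthe K))^-1%g; (elem i2 (Rthe K))^-1%g;
  elem i2 (Rthe K); elem i2 (Pthe K)] i).
split=> [[|[|[|[|[|i]]]]] //|[|[|[|[|[|i]]]]] //|].
rewrite big_ltn // big_ltn // big_ltn // big_ltn // big_geq //= mul1g !mulg1.
by rewrite /theta !mulgA.
Qed.

Theorem theorem2 (K : fieldType) (hK : ([pchar K] =i pred0)%R)
    (m : nat) (hm : (1 <= m)%N) :
  (forall phi : GA 3 K, m_triangular m phi -> affine phi \/ cotame phi)
  <-> (m <= 3)%N.
Proof.
split=> [h|m3 phi]; last exact: cotame_le3.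
rewrite leqNgt; apply/negP => m4.
have [] := h (theta K) (m_triangular_le m4 (theta_4_triangular K)).
  exact: theta_not_affine.
exact: theta_not_cotame.
Qed.
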